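(* Let $n\ge 3$, $\lambda>-\frac{(n-2)^2}{4}$ and $2\kappa=n-2-\sqrt{(n-2)^2+4\lambda}$. Assume that $$0<\alpha<n,\qquad 2\kappa<n-2-\frac{2(n-2)}{3n-2+2\sqrt{9n^2+8n-16}},$$ and that $$\frac{\alpha}{2}-\frac{n+2+\sqrt{9n^2+8n-16}}{2}<\tau<\frac{\alpha}{2}-\max\Big\{\frac{n-4}{2},\ \frac{n-4}{n},\ \frac{\kappa}{n-2-2\kappa}-\frac n4\Big\}.$$ Let $p=1+\frac{2-2\tau+\alpha}{n-2}$, let $\varphi$ be a ground state, and let $u\in C([0,T^* );H^1_\lambda)$ be a maximal solution of the focusing problem $$i\partial_t u-\mathcal K_\lambda u=-|x|^{-\tau}|u|^{p-2}\big(I_\alpha*|\cdot|^{-\tau}|u|^p\big)u,\qquad u(\cdot,0)=u_0\in H^1_\lambda .$$ If $$\sup_{t\in[0,T^* )}\frac{\mathcal P[u(t)]}{\mathcal P[\varphi]}<1,$$ then $u$ is bounded in $H^1_\lambda$, i.e. $\sup_{t\in[0,T^* )}\|u(t)\|_{H^1_\lambda}<\infty$.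
   Context: $\|\cdot\|$ denotes the $L^2(\mathbb{R}^n)$ norm. $\mathcal K_\lambda=-\Delta+\frac{\lambda}{|x|^2}$ is the positive self-adjoint (Friedrichs) extension on $L^2(\mathbb{R}^n)$, so that $\|\sqrt{\mathcal K_\lambda}u\|^2=\|\nabla u\|^2+\lambda\||x|^{-1}u\|^2$. $H^1_\lambda$ and $W^{1,r}_\lambda$ are the completions of $C_0^\infty(\mathbb{R}^n)$ for the norms $\|\langle\sqrt{\mathcal K_\lambda}\rangle u\|_{L^2}$ and $\|\langle\sqrt{\mathcal K_\lambda}\rangle u\|_{L^r}$, with $\langle\cdot\rangle=(1+|\cdot|^2)^{1/2}$. The Riesz potential is $I_\alpha(x)=\frac{\Gamma(\frac{n-\alpha}{2})}{\Gamma(\frac\alpha2)\pi^{n/2}2^\alpha}|x|^{\alpha-n}$, and $\mathcal P[u]=\int_{\mathbb{R}^n}|x|^{-\tau}\big(I_\alpha*|\cdot|^{-\tau}|u|^p\big)|u|^p\,dx$. The (focusing) energy is $\mathcal E[u]=\|\sqrt{\mathcal K_\lambda}u\|^2-\frac1p\mathcal P[u]$. The standing assumption on the exponent is $p>2$. A ground state is a solution $0\ne\varphi\in H^1_\lambda$ of $-\Delta\varphi+\frac{\lambda}{|x|^2}\varphi=|x|^{-\tau}|\varphi|^{p-2}(I_\alpha*|\cdot|^{-\tau}|\varphi|^p)\varphi$ which minimizes $\|\sqrt{\mathcal K_\lambda}w\|^{2p}/\mathcal P[w]$ over $0\ne w\in H^1_\lambda$. Solutions are Duhamel solutions in the well-posedness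 class $C([0,T];H^1_\lambda)\cap L^q([0,T];W^{1,r}_\lambda)$ for every $T<T^*$ and every admissible pair $(q,r)$ (i.e. $2\le q\le\infty$, $2\le r\le\frac{2n}{n-2}$, $\frac2q+\frac nr=\frac n2$); they conserve mass $\|u(t)\|^2$ and energy $\mathcal E[u(t)]$; $[0,T^* )$ is the maximal forward interval of existence. *)

(* Defs.v *)
From HB Require Import structures.
From mathcomp Require Import all_boot all_order all_algebra.
From mathcomp Require Import all_classical all_reals all_analysis.
From mathcomp Require Import complex.
Set Implicit Arguments.
Unset Strict Implicit.
Unset Printing Implicit Defensive.
Import Order.TTheory GRing.Theory Num.Theory.
Import numFieldNormedType.Exports.
Import ComplexField.Normc.
Local Open Scope classical_set_scope.
Local Open Scope ring_scope.

(* Lebesgue measure on R^n, R^n being [n.-tuple R] with its product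
   sigma-algebra: the image of (dx \x dx^n) under (x, y) |-> x :: y. *)
Section lebesgue_tuple.
Context {R : realType}.

Definition tcons n (z : R * n.-tuple R) : n.+1.-tuple R := [tuple of z.1 :: z.2].

Lemma measurable_tcons n : measurable_fun setT (@tcons n).
Proof. exact: measurable_cons. Qed.

Let uncons n (x : n.+1.-tuple R) : R * n.-tuple R :=
  (tnth x ord0, [tuple of behead x]).

Let measurable_uncons n : measurable_fun setT (@uncons n).
Proof.
apply/measurable_fun_pairP; split => /=.
  exact: measurable_tnth.
exact: measurable_behead.
Qed.

Let tconsK n : cancel (@tcons n) (@uncons n).
Proof.
move=> [x s]; rewrite /uncons /tcons /=; congr pair; exact/val_inj.
Qed.

Section step.
Variables (n : nat) (m : {sigma_finite_measure set (n.-tuple R) -> \bar R}).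


Definition lebesgue_step : set (n.+1.-tuple R) -> \bar R :=
  pushforward (lebesgue_measure \x m)%E (@tcons n).

Let step0 : lebesgue_step set0 = 0%E.
Proof. by apply: measure0; exact: measurable_tcons. Qed.

Let step_ge0 A : (0 <= lebesgue_step A)%E.
Proof. by apply: measure_ge0; exact: measurable_tcons. Qed.

Let step_sigma_additive : semi_sigma_additive lebesgue_step.
Proof. by apply: measure_semi_sigma_additive; exact: measurable_tcons. Qed.

HB.instance Definition _ := isMeasure.Build _ _ _ lebesgue_step
  step0 step_ge0 step_sigma_additive.

Let step_sigma_finite : sigma_finite setT lebesgue_step.
Proof.
have /sigma_finiteP[F [FT ndF Foo]] := sigma_finiteT (@lebesgue_measure R).
have /sigma_finiteP[G [GT ndG Goo]] := sigma_finiteT m.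
exists (fun k => @uncons n @^-1` (F k `*` G k)).
  rewrite -preimage_bigcup (_ : \bigcup_k _ = setT) ?preimage_setT//.
  apply/seteqP; split=> // -[x y] _.
  have [i _ Fix] : (\bigcup_i F i) x by rewrite -FT.
  have [j _ Gjy] : (\bigcup_j G j) y by rewrite -GT.
  exists (maxn i j) => //; split.
    by move: x Fix; exact/subsetPset/ndF/leq_maxl.
  by move: y Gjy; exact/subsetPset/ndG/leq_maxr.
move=> k; have [mF Fk] := Foo k; have [mG Gk] := Goo k; split.
  rewrite -[X in measurable X]setTI; apply: measurable_uncons => //.
  exact: measurableX.
rewrite /lebesgue_step /pushforward -comp_preimage.
rewrite (_ : _ \o _ = id); last by apply/funext => z /=; exact: tconsK.
by rewrite preimage_id product_measure1E// lte_mul_pinfty// ge0_fin_numE.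
Qed.

HB.instance Definition _ := Measure_isSigmaFinite.Build _ _ _ lebesgue_step
  step_sigma_finite.
End step.

Fixpoint lebesgue_tuple n : {sigma_finite_measure set (n.-tuple R) -> \bar R} :=
  match n with
  | 0%N => dirac [tuple]
  | k.+1 => lebesgue_step (lebesgue_tuple k)
  end.
End lebesgue_tuple.

Section euclidean.
Context {R : realType} {n : nat}.
Implicit Types x y : n.-tuple R.

Definition enorm x : R := Num.sqrt (\sum_(i < n) tnth x i ^+ 2).

Definition tsub x y : n.-tuple R := [tuple tnth x i - tnth y i | i < n].

(* The differential calculus of the library lives on ['rV[R]_n]. *)
Definition row_of_tuple x : 'rV[R]_n := \row_i tnth x i.

Definition tuple_of_row (v : 'rV[R]_n) : n.-tuple R := [tuple v ord0 i | i < n].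

End euclidean.

Section complex_functions.
Context {R : realType}.

Definition cintegral d (T : measurableType d) (mu : {measure set T -> \bar R})
    (D : set T) (f : T -> R[i]) : R[i] :=
  ((\int[mu]_(x in D) complex.Re (f x)) +i* (\int[mu]_(x in D) complex.Im (f x)))%C.

Variable n : nat.

(* Complex functions on R^n; those of L^2, H^1_lambda, etc are considered up to
   equality almost everywhere. *)
Definition fn := n.-tuple R -> R[i].

Implicit Types u v w : fn.

Definition Lp (r : R) u : \bar R :=
  Lnorm (lebesgue_tuple n) r%:E (fun x => (normc (u x))%:E).

Definition in_Lp r u :=
  [/\ measurable_fun setT (fun x => complex.Re (u x)),
      measurable_fun setT (fun x => complex.Im (u x)) &
      (Lp r u < +oo)%E].

Definition aeq u v := {ae lebesgue_tuple n, forall x, u x = v x}.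

Definition inner u v : R[i] :=
  cintegral (lebesgue_tuple n) setT (fun x => u x * (v x)^*%C).

Definition cvg_Lp r (u_ : nat -> fn) u :=
  Lp r (u_ k \- u) @[k --> \oo] --> 0%E.

End complex_functions.
Arguments fn R n : clear implicits.

Section test_functions.
Context {R : realType} (n : nat).

Fixpoint Ck k (f : 'rV[R]_n -> R) : Prop :=
  continuous f /\
  match k with
  | 0%N => True
  | k'.+1 => forall i : 'I_n,
      (forall x, derivable f x (delta_mx ord0 i)) /\
      Ck k' (fun x => 'D_(delta_mx ord0 i) f x)
  end.

(* C_0^oo(R^n; C) *)
Definition test (u : fn R n) :=
  [/\ forall k, Ck k (fun v => complex.Re (u (tuple_of_row v))),
      forall k, Ck k (fun v => complex.Im (u (tuple_of_row v))) &
      exists M : R, forall x, M < enorm x -> u x = 0].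

Definition partial (i : 'I_n) (u : fn R n) : fn R n := fun x =>
  ('D_(delta_mx ord0 i) (fun v => complex.Re (u (tuple_of_row v)) : R) (row_of_tuple x)
   +i* 'D_(delta_mx ord0 i) (fun v => complex.Im (u (tuple_of_row v)) : R)
         (row_of_tuple x))%C.

End test_functions.

(* K_lambda = - Delta + lambda / |x|^2 as the Friedrichs extension: the
   self-adjoint operator of the closure of the form
     <grad u, grad v> + lambda <|x|^-2 u, v>   on C_0^oo.
   [Kop lam u f] reads: u is in the domain and K_lambda u = f. *)
Section operator.
Context {R : realType} {n : nat}.
Variable lam : R.
Implicit Types u v f : fn R n.

Definition Kform u v : R[i] :=
  \sum_(i < n) inner (partial i u) (partial i v) +
  lam%:C%C * inner (fun x => ((enorm x ^+ 2)^-1)%:C%C * u x) v.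

Definition Kop u f :=
  [/\ in_Lp 2 u, in_Lp 2 f & exists phi : nat -> fn R n,
    [/\ forall k, test (phi k),
        cvg_Lp 2 phi u,
        forall e : R, 0 < e -> exists N, forall j k, (N <= j)%N -> (N <= k)%N ->
          normc (Kform (phi j \- phi k) (phi j \- phi k)) < e &
        forall psi, test psi ->
          normc (Kform (phi k) psi - inner f psi) @[k --> \oo] --> (0 : R)]].

End operator.

Section functional_calculus.
Context {R : realType} {n : nat}.
Implicit Types u v w : fn R n.

(* Projection-valued measures on [0, +oo[ acting on L^2(R^n), i.e. spectral
   resolutions of positive self-adjoint operators; [pvm_mu E u] is the measure
   B |-> ||E(B) u||^2 = <E(B) u, u>. *)
Record pvm := PVM {
  pvm_proj :> set R -> fn R n -> fn R n ;
  pvm_mu : fn R n -> {measure set R -> \bar R} ;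
  pvm_L2 : forall B u, measurable B -> in_Lp 2 u -> in_Lp 2 (pvm_proj B u) ;
  pvm_ae : forall B u v, measurable B -> in_Lp 2 u -> in_Lp 2 v ->
    aeq u v -> aeq (pvm_proj B u) (pvm_proj B v) ;
  pvm_linear : forall B (a : R[i]) u v, measurable B -> in_Lp 2 u -> in_Lp 2 v ->
    aeq (pvm_proj B (fun x => a * u x + v x))
        (fun x => a * pvm_proj B u x + pvm_proj B v x) ;
  pvm_sym : forall B u v, measurable B -> in_Lp 2 u -> in_Lp 2 v ->
    inner (pvm_proj B u) v = inner u (pvm_proj B v) ;
  pvm_mul : forall B B' u, measurable B -> measurable B' -> in_Lp 2 u ->
    aeq (pvm_proj B (pvm_proj B' u)) (pvm_proj (B `&` B') u) ;
  pvm_setT : forall u, in_Lp 2 u -> aeq (pvm_proj setT u) u ;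
  pvm_ge0 : forall u, in_Lp 2 u -> aeq (pvm_proj `]-oo, 0[ u) (cst 0) ;
  pvm_muE : forall B u, measurable B -> in_Lp 2 u ->
    (pvm_mu u B = Lp 2 (pvm_proj B u) ^+ 2)%E
}.

(* complex simple functions \sum_i c_i 1_(B_i) on the real line *)
Record step := Step {
  step_len : nat ;
  step_coef : 'I_step_len -> R[i] ;
  step_set : 'I_step_len -> set R ;
  step_meas : forall i, measurable (step_set i)
}.

Definition step_fun (c : step) (s : R) : R[i] :=
  \sum_(i < step_len c) step_coef i * (\1_(step_set i) s)%:C%C.

Definition step_op (E : pvm) (c : step) u : fn R n := fun x =>
  \sum_(i < step_len c) step_coef i * E (step_set i) u x.

(* [fcalc E g u v] reads: u is in the domain of g(A) = \int g dE and
   g(A) u = v, as the L^2-limit of the (\int g_k dE) u for simple functions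
   g_k --> g in L^2(||E(.) u||^2). *)
Definition fcalc (E : pvm) (g : R -> R[i]) u v :=
  [/\ in_Lp 2 u, in_Lp 2 v & exists c : nat -> step,
    (\int[pvm_mu E u]_s ((normc (step_fun (c k) s - g s)) ^+ 2)%:E)%E
      @[k --> \oo] --> 0%E /\
    cvg_Lp 2 (fun k => step_op E (c k) u) v].

Definition is_spectral_resolution (A : fn R n -> fn R n -> Prop) (E : pvm) :=
  forall u f, A u f <-> fcalc E (fun s => s%:C%C) u f.


(* the resolution of the zero operator, used as a default value *)
Let proj0 (B : set R) u : fn R n := if `[< B 0 >] then u else cst 0.

Let mu0 u : {measure set R -> \bar R} :=
  mscale (`|fine (Lp 2 u)| ^+ 2)%:nng (dirac (0 : R)).

Let Lp_cst0 : Lp 2 (cst 0 : fn R n) = 0%E.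
Proof.
rewrite /Lp unlock/= integral0_eq => [|x _]; first by rewrite poweR0r// invr_neq0.
by rewrite /normc/= expr0n/= addr0 sqrtr0 normr0 powR0.
Qed.

Let in_Lp_cst0 : in_Lp 2 (cst 0 : fn R n).
Proof. by split; [exact: measurable_cst|exact: measurable_cst|rewrite Lp_cst0]. Qed.

Let aeq_refl u : aeq u u. Proof. by apply: aeW. Qed.

Let inner0l v : inner (cst 0) v = 0.
Proof.
rewrite /inner /cintegral /Rintegral !integral0_eq//= => x _; by rewrite mul0r.
Qed.

Let inner0r v : inner v (cst 0) = 0.
Proof.
by rewrite /inner /cintegral /Rintegral !integral0_eq//= => x _; rewrite oppr0 mulr0.
Qed.

Definition pvm0 : pvm.
Proof.
refine (@PVM proj0 mu0 _ _ _ _ _ _ _ _) => //.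
- by move=> B u _ Lu; rewrite /proj0; case: ifP.
- by move=> B u v _ _ _ uv; rewrite /proj0; case: ifP.
- move=> B a u v _ _ _; rewrite /proj0; case: ifP => // _.
  by apply: aeW => x /=; rewrite mulr0 addr0.
- by move=> B u v _ _ _; rewrite /proj0; case: ifP; rewrite ?inner0l ?inner0r.
- move=> B B' u _ _ _; rewrite /proj0 asbool_and.
  by case: asboolP; case: asboolP.
- by move=> u _; rewrite /proj0 asboolT.
- by move=> u _; rewrite /proj0 asboolF//= in_itv/= ltxx.
- move=> B u mB [_ _ Lu]; rewrite /mu0 /= /mscale/= /dirac indicE /proj0.
  case: asboolP => B0; last by rewrite memNset// mule0 Lp_cst0/= mule0.
  rewrite mem_set// mule1 real_normK ?num_real// EFin_expe fineK//.
  by rewrite ge0_fin_numE// /Lp Lnorm_ge0.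
Qed.

(* The spectral resolution of a positive self-adjoint operator A, which exists
   and is unique by the spectral theorem. *)
Definition spectral (A : fn R n -> fn R n -> Prop) : pvm :=
  if pselect (exists E, is_spectral_resolution A E) is left h
  then sval (cid h) else pvm0.

End functional_calculus.

Section spaces.
Context {R : realType} {n : nat}.
Variable lam : R.
Implicit Types u v w : fn R n.

(* [K_fun g u v] reads: u is in the domain of g(K_lambda) and g(K_lambda) u = v. *)
Definition K_fun (g : R -> R[i]) u v := fcalc (spectral (Kop lam)) g u v.

Definition sqrtK u v := K_fun (fun s => (Num.sqrt s)%:C%C) u v.

Definition bracketK u v := K_fun (fun s => (Num.sqrt (1 + s))%:C%C) u v.

(* v = exp(- i t K_lambda) u *)
Definition propagator (t : R) u v :=
  K_fun (fun s => (cos (t * s) -i* sin (t * s))%C) u v.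

(* The completion W^{1,r}_lambda of C_0^oo for the norm ||<sqrt K> u||_{L^r},
   realized inside L^r: the pairs (u, v) that are limits in L^r of pairs
   (phi, <sqrt K> phi) with phi in C_0^oo. The norm of u is then ||v||_{L^r}
   (and +oo when u is not in W^{1,r}_lambda). *)
Definition W_graph (r : R) u v :=
  [/\ in_Lp r u, in_Lp r v & exists phi psi : nat -> fn R n,
    [/\ forall k, [/\ test (phi k), bracketK (phi k) (psi k) & in_Lp r (psi k)],
        cvg_Lp r phi u & cvg_Lp r psi v]].

Definition in_W r u := exists v, W_graph r u v.

Definition W_norm r u : \bar R := ereal_inf [set Lp r v | v in W_graph r u].

(* H^1_lambda = W^{1,2}_lambda *)
Definition in_H1 u := in_W 2 u.
Definition H1_norm u : \bar R := W_norm 2 u.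

(* ||sqrt K u||_{L^2}, equal to +oo when u is not in the domain of sqrt K *)
Definition sqrtK_norm u : \bar R := ereal_inf [set Lp 2 v | v in sqrtK u].

End spaces.

Section nonlinearity.
Context {R : realType} {n : nat}.
Variables (lam alpha tau p : R).
Implicit Types u w phi psi : fn R n.

Definition Gamma (x : R) : R :=
  \int[lebesgue_measure]_(t in `]0, +oo[) (t `^ (x - 1) * expR (- t)).

(* the value at the origin is irrelevant *)
Definition riesz (x : n.-tuple R) : R :=
  Gamma ((n%:R - alpha) / 2) /
    (Gamma (alpha / 2) * pi `^ (n%:R / 2) * 2 `^ alpha) *
  enorm x `^ (alpha - n%:R).

Definition riesz_conv u (x : n.-tuple R) : \bar R :=
  (\int[lebesgue_tuple n]_y
     (riesz (tsub x y) * (enorm y `^ (- tau) * normc (u y) `^ p))%:E)%E.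

Definition Pfunctional u : \bar R :=
  (\int[lebesgue_tuple n]_x
     ((enorm x `^ (- tau))%:E * riesz_conv u x * (normc (u x) `^ p)%:E))%E.

Definition energy u : \bar R := (sqrtK_norm lam u ^+ 2 - p^-1%:E * Pfunctional u)%E.

Definition nonlin u : fn R n := fun x =>
  (enorm x `^ (- tau) * normc (u x) `^ (p - 2) * fine (riesz_conv u x))%:C%C * u x.

(* \int |nonlin u| |w|, computed in the extended reals: the pairing of [nonlin u]
   and w converges absolutely when it is finite. *)
Definition abs_pairing u w : \bar R :=
  (\int[lebesgue_tuple n]_x
     ((enorm x `^ (- tau) * normc (u x) `^ (p - 1))%:E * riesz_conv u x *
      (normc (w x))%:E))%E.

(* K_lambda phi = nonlin phi, in the sense of the duality of H^1_lambda and
   its dual *)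
Definition elliptic phi :=
  exists2 f, sqrtK lam phi f & forall psi g, in_H1 lam psi -> sqrtK lam psi g ->
    (abs_pairing phi psi < +oo)%E /\ inner f g = inner (nonlin phi) psi.

Definition quotient w : \bar R := (sqrtK_norm lam w `^ (2 * p) / Pfunctional w)%E.

Definition ground_state phi :=
  [/\ in_H1 lam phi, ~ aeq phi (cst 0), elliptic phi &
      forall w, in_H1 lam w -> ~ aeq w (cst 0) ->
        (quotient phi <= quotient w)%E].

End nonlinearity.

Section evolution.
Context {R : realType} {n : nat}.
Variables (lam alpha tau p : R).
Implicit Types (u : R -> fn R n) (T : R).

(* 2/q + n/r = n/2 with 2 <= q <= oo and 2 <= r <= 2n/(n-2) *)
Definition admissible (q : \bar R) (r : R) :=
  [/\ (2%:E <= q)%E, 2 <= r <= 2 * n%:R / (n%:R - 2) &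
      (2%:E / q + (n%:R / r)%:E = (n%:R / 2)%:E)%E].

Definition in_CH1 T u := forall t, t \in `[0, T] ->
  in_H1 lam (u t) /\
  H1_norm lam (u s \- u t) @[s --> within `[0, T] (nbhs t)] --> 0%E.

(* Bochner space L^q([0,T]; W^{1,r}_lambda): u is a.e. the limit in
   W^{1,r}_lambda of simple functions \sum_i 1_(B_i)(t) w_i, and the norm of
   u(t) is in L^q([0,T]) *)
Definition in_LqW (q : \bar R) r T u :=
  (exists (len : nat -> nat) (B : forall k, 'I_(len k) -> set R)
          (w : forall k, 'I_(len k) -> fn R n),
     (forall k i, measurable (B k i) /\ in_W lam r (w k i)) /\
     {ae lebesgue_measure, forall t, t \in `[0, T] ->
       W_norm lam r ((fun x => \sum_(i < len k) (\1_(B k i) t)%:C%C * w k i x)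
                     \- u t) @[k --> \oo] --> 0%E}) /\
  (Lnorm lebesgue_measure q ((fun t => W_norm lam r (u t)) \_ `[0%R, T]) < +oo)%E.

(* The Duhamel formula
     u(t) = exp(-itK) u0 + i \int_0^t exp(-i(t-s)K) nonlin(u(s)) ds
   in the dual of H^1_lambda: nonlin(u(s)) lies in that space only, so the
   formula is paired with w in H^1_lambda, and the propagator moved to w. *)
Definition duhamel (u0 : fn R n) u (t : R) :=
  forall (w v0 : fn R n) (W : R -> fn R n), in_H1 lam w ->
    propagator lam t u0 v0 ->
    (forall s, s \in `[0, t] -> propagator lam (s - t) w (W s)) ->
    (\int[lebesgue_measure]_(s in `[0%R, t]) abs_pairing alpha tau p (u s) (W s)
       < +oo)%E /\
    inner (u t) w = inner v0 w +
      'i%C * cintegral lebesgue_measure `[0, t]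
               (fun s => inner (nonlin alpha tau p (u s)) (W s)).

Definition forward (T : \bar R) : set R := [set t | 0 <= t /\ (t%:E < T)%E].

(* Solutions on [0, Tmax) in the well-posedness class; conservation of mass and
   energy is part of the notion. *)
Definition solution (Tmax : \bar R) (u0 : fn R n) u :=
  [/\ aeq (u 0) u0,
      forall T, forward Tmax T -> in_CH1 T u /\
        forall q r, admissible q r -> in_LqW q r T u,
      forall t, forward Tmax t -> duhamel u0 u t,
      forall t, forward Tmax t -> Lp 2 (u t) = Lp 2 u0 &
      forall t, forward Tmax t ->
        energy lam alpha tau p (u t) = energy lam alpha tau p u0].

(* u has no extension to a solution on a larger interval *)
Definition maximal_solution (Tmax : \bar R) (u0 : fn R n) u :=
  solution Tmax u0 u /\
  forall (T : \bar R) v, (Tmax < T)%E -> solution T u0 v ->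
    ~ (forall t, forward Tmax t -> aeq (v t) (u t)).

End evolution.

Definition kappa {R : realType} (n : nat) (lam : R) : R :=
  (n%:R - 2 - Num.sqrt ((n%:R - 2) ^+ 2 + 4 * lam)) / 2.

(* Main.v *)
Require Import Defs.
From HB Require Import structures.
From mathcomp Require Import all_boot all_order all_algebra.
From mathcomp Require Import all_classical all_reals all_analysis.
From mathcomp Require Import measurable_realfun complex ring lra.
Set Implicit Arguments.
Unset Strict Implicit.
Unset Printing Implicit Defensive.
Import Order.TTheory GRing.Theory Num.Theory.
Import numFieldNormedType.Exports.
Import ComplexField.Normc.
Local Open Scope classical_set_scope.
Local Open Scope ring_scope.

(* Mass and energy are conserved, and testing the equation of [phi] against
   [phi] shows that [P[phi]] is finite. Hence [P[u(t)] <= P[phi]] bounds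
   [||sqrt K u(t)||^2 = E[u0] + P[u(t)] / p], and with the mass the H^1 norm.

   The H^1 norm is defined by closure of test functions while [sqrt K] is
   defined by the spectral resolution, so the two have to be compared. If
   [g(K) u = v], then the spectral measures satisfy [d mu_v = |g|^2 d mu_u].
   For the slices [B = [j, j + 1[] the masses [mu_v(B)] and [(1 + j) mu_u(B)] are
   then comparable for [v = <sqrt K> u] with [u] a test function, hence, by
   continuity of [u |-> mu_u(B)] in L^2, for all [u] in H^1; summing over [j]
   compares [||v||^2] with the integral of [1 + s] against [mu_u]. The finiteness
   of that integral puts [u] in the domain of [sqrt K], the vector [sqrt K u]
   being a limit of simple functions of [K] applied to [u], by completeness of
   L^2. *)

(** * Square-integrable complex functions *)

Lemma sqr_normcE {R : realType} (z : R[i]) :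
  normc z ^+ 2 = complex.Re z ^+ 2 + complex.Im z ^+ 2.
Proof. by case: z => a b; rewrite /normc /= sqr_sqrtr// addr_ge0// sqr_ge0. Qed.

(* Both [x k + 2 C 2^-k] and [x k - 2 C 2^-k] are monotone. *)
Lemma geometric_cauchy_cvg {R : realType} (x : R^nat) (C : R) : 0 <= C ->
  (forall k, `|x k.+1 - x k| <= C / 2 ^+ k) ->
  cvgn x /\ forall k, `|limn x - x k| <= 2 * C / 2 ^+ k.
Proof.
move=> C0 xC; pose e k : R := 2 * C / 2 ^+ k.
have eS k : e k.+1 = C / 2 ^+ k.
  by rewrite /e exprS invfM mulrACA divff ?mul1r// pnatr_eq0.
have ee k : e k = C / 2 ^+ k *+ 2 by rewrite /e mulr2n; ring.
have e0 k : 0 <= e k by rewrite /e divr_ge0 ?mulr_ge0// exprn_ge0.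
have ecvg : e @ \oo --> 0.
  rewrite (_ : e = geometric (2 * C) 2^-1); last first.
    by apply/funext => k; rewrite /e /= exprVn.
  by apply: cvg_geometric; rewrite ger0_norm ?invf_lt1 ?ltr1n.
pose y k := x k + e k; pose z k := x k - e k.
have ynd : {homo y : n m / (n <= m)%N >-> m <= n}.
  apply/nonincreasing_seqP => k; rewrite /y eS ee.
  by have := xC k; rewrite ler_norml => /andP[? ?]; lra.
have znd : {homo z : n m / (n <= m)%N >-> n <= m}.
  apply/nondecreasing_seqP => k; rewrite /z eS ee.
  by have := xC k; rewrite ler_norml => /andP[? ?]; lra.
have zy j k : z j <= y k.
  apply: (@le_trans _ _ (z (maxn j k))); first by apply: znd; exact: leq_maxl.
  apply: (@le_trans _ _ (y (maxn j k))); last by apply: ynd; exact: leq_maxr.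
  by rewrite /z /y; have := e0 (maxn j k); lra.
have cy : cvgn y.
  apply: nonincreasing_is_cvgn => //.
  by exists (z 0%N) => _ [k _ <-]; exact: zy.
have xl : x @ \oo --> limn y.
  rewrite (_ : x = (y \- e)); last by apply/funext => k; rewrite /y/= addrK.
  by rewrite -[limn y]subr0; exact: cvgB.
split; first by apply/cvg_ex; eexists; exact: xl.
move=> k; rewrite (cvg_lim _ xl)// -/(e k) ler_norml; apply/andP; split.
  have : z k <= limn y by apply: limr_ge => //; apply: nearW => j; exact: zy.
  by rewrite /z; lra.
by have := nonincreasing_cvgn_ge ynd cy k; rewrite /y; lra.
Qed.

Section square_integrable.
Context d (T : measurableType d) (R : realType).
Variable mu : {measure set T -> \bar R}.
Implicit Types f g h : T -> R[i].

(** The squared L^2 norm for an arbitrary measure, so that the same lemmas serve Lebesgue measure on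
    R^n and the spectral measures on the line. *)
Definition sqint f : \bar R := (\int[mu]_x (normc (f x) ^+ 2)%:E)%E.

Definition cmeasurable f :=
  measurable_fun setT (fun x => complex.Re (f x)) /\
  measurable_fun setT (fun x => complex.Im (f x)).

Definition L2 f := cmeasurable f /\ (sqint f < +oo)%E.

(** At Lebesgue measure this is [inner], by conversion. *)
Definition cip f g : R[i] := cintegral mu setT (fun x => f x * (g x)^*%C).

Lemma cmeasurable_lin (a : R[i]) f g : cmeasurable f -> cmeasurable g ->
  cmeasurable (fun x => a * f x + g x).
Proof.
case: a => a b [mf1 mf2] [mg1 mg2]; split.
- rewrite (_ : (fun _ => _) = (fun x => a * complex.Re (f x) - b * complex.Im (f x)
      + complex.Re (g x))); last by apply/funext => x; case: (f x); case: (g x).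
  by apply: measurable_funD => //; apply: measurable_funB; exact: measurable_funM.
- rewrite (_ : (fun _ => _) = (fun x => a * complex.Im (f x) + b * complex.Re (f x)
      + complex.Im (g x))); last by apply/funext => x; case: (f x); case: (g x).
  by apply: measurable_funD => //; apply: measurable_funD; exact: measurable_funM.
Qed.

Lemma cmeasurableB f g : cmeasurable f -> cmeasurable g -> cmeasurable (f \- g).
Proof.
move=> mf mg; rewrite (_ : f \- g = (fun x => -1 * g x + f x)).
  exact: cmeasurable_lin.
by apply/funext => x; rewrite mulN1r addrC.
Qed.

Lemma measurable_sqr_normc f : cmeasurable f ->
  measurable_fun setT (fun x => normc (f x) ^+ 2).
Proof.
move=> [m1 m2]; under eq_fun do rewrite sqr_normcE.
by apply: measurable_funD; exact: measurable_funX.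
Qed.

Lemma sqint_ge0 f : (0 <= sqint f)%E.
Proof. by apply: integral_ge0 => x _; rewrite lee_fin sqr_ge0. Qed.

Lemma fin_sqint f : L2 f -> sqint f \is a fin_num.
Proof. by case=> _ foo; rewrite ge0_fin_numE// sqint_ge0. Qed.

Lemma sqint_aeq f g : cmeasurable f -> cmeasurable g ->
  {ae mu, forall x, f x = g x} -> sqint f = sqint g.
Proof.
move=> mf mg fg; apply: ae_eq_integral => //.
- exact/measurable_EFinP/measurable_sqr_normc.
- exact/measurable_EFinP/measurable_sqr_normc.
- by apply: filterS fg => x -> _.
Qed.

(** The right side exceeds the left by |z - 2 w|^2. This stands in for the triangle inequality:
    squared norms are compared up to constants throughout. *)
Lemma sqr_normcD_le (z w : R[i]) :
  normc z ^+ 2 <= 2 * normc w ^+ 2 + 2 * normc (z - w) ^+ 2.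
Proof.
rewrite !sqr_normcE; case: z => a b; case: w => c e /=.
have := sqr_ge0 (a - c - c); have := sqr_ge0 (b - e - e); rewrite !expr2; nra.
Qed.

(** The error is integrated over the whole space, so that one quantity tending to 0 serves every set
    [D]. *)
Lemma le_sqint (D : set T) f g : measurable D -> cmeasurable f -> cmeasurable g ->
  (\int[mu]_(x in D) (normc (f x) ^+ 2)%:E <=
   2%:E * \int[mu]_(x in D) (normc (g x) ^+ 2)%:E + 2%:E * sqint (f \- g)%R)%E.
Proof.
move=> mD mf mg; have mfg := cmeasurableB mf mg.
have mD2 h : cmeasurable h -> measurable_fun D (fun x => (normc (h x) ^+ 2)%:E).
  by move=> mh; apply/measurable_EFinP/measurable_funTS/measurable_sqr_normc.
have D0 h x : D x -> (0 <= (normc (h x) ^+ 2)%:E)%E by rewrite lee_fin sqr_ge0.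
apply: (@le_trans _ _
  (\int[mu]_(x in D) (2%:E * (normc (g x) ^+ 2)%:E +
                      2%:E * (normc ((f \- g) x) ^+ 2)%:E))%E).
  apply: ge0_le_integral => //.
  - exact: D0.
  - exact: mD2.
  - by apply: emeasurable_funD; apply: measurable_funeM; exact: mD2.
  - by move=> x Dx; rewrite -!EFinM -EFinD lee_fin; exact: sqr_normcD_le.
have m2 h : cmeasurable h ->
    measurable_fun D (fun x => 2%:E * (normc (h x) ^+ 2)%:E)%E.
  by move=> mh; apply: measurable_funeM; exact: mD2.
rewrite ge0_integralD//; first last.
- exact: m2.
- by move=> x Dx; rewrite mule_ge0// D0.
- exact: m2.
- by move=> x Dx; rewrite mule_ge0// D0.
rewrite !ge0_integralZl_EFin//; [|exact: D0|exact: mD2|exact: D0|exact: mD2].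
apply: leeD => //; apply: lee_wpmul2l => //.
apply: ge0_subset_integral => //.
- exact/measurable_EFinP/measurable_sqr_normc.
- by move=> x _; rewrite lee_fin sqr_ge0.
Qed.

Lemma sqint_le2 f g : cmeasurable f -> cmeasurable g ->
  (sqint f <= 2%:E * sqint g + 2%:E * sqint (f \- g)%R)%E.
Proof. exact: le_sqint. Qed.

Lemma sqint_subC f g : sqint (f \- g) = sqint (g \- f).
Proof.
apply: eq_integral => x _ /=.
by rewrite !sqr_normcE; case: (f x) => ? ?; case: (g x) => ? ? /=; congr (_%:E); ring.
Qed.

Lemma sqintZ (a : R[i]) f : cmeasurable f ->
  sqint (fun x => a * f x) = ((normc a ^+ 2)%:E * sqint f)%E.
Proof.
move=> mf; rewrite /sqint.
under eq_integral do rewrite normcM exprMn EFinM.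
rewrite ge0_integralZl_EFin ?sqr_ge0//.
- by move=> x _; rewrite lee_fin sqr_ge0.
- exact/measurable_EFinP/measurable_sqr_normc.
Qed.

Lemma L2_cst0 : L2 (cst 0).
Proof.
split; first by split; exact: measurable_cst.
by rewrite /sqint integral0_eq// => x _; rewrite normc0 expr0n.
Qed.

Lemma L2_lin (a : R[i]) f g : L2 f -> L2 g -> L2 (fun x => a * f x + g x).
Proof.
move=> [mf foo] [mg goo].
have mag := cmeasurable_lin a mf mg.
split => //; apply: le_lt_trans (sqint_le2 mag mg) _.
rewrite (_ : _ \- _ = fun x => a * f x); last by apply/funext => x /=; rewrite addrK.
by rewrite sqintZ// lte_add_pinfty// ?lte_mul_pinfty// ?lee_fin// sqr_ge0.
Qed.

Lemma L2B f g : L2 f -> L2 g -> L2 (f \- g).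
Proof.
move=> Lf Lg; rewrite (_ : f \- g = (fun x => -1 * g x + f x)); first exact: L2_lin.
by apply/funext => x; rewrite mulN1r addrC.
Qed.

Lemma L2_sum n (c : 'I_n -> R[i]) (f : 'I_n -> T -> R[i]) : (forall i, L2 (f i)) ->
  L2 (fun x => \sum_(i < n) c i * f i x).
Proof.
elim: n => [|n IH] in c f * => Lf.
  by under eq_fun do rewrite big_ord0; exact: L2_cst0.
under eq_fun do rewrite big_ord_recl.
by apply: L2_lin => //; exact: IH.
Qed.

(** Both components of the product are dominated by |f|^2 + |g|^2, as squares of sums and
    differences of the components of [f] and [g] are nonnegative. *)
Lemma L2_integrable_prod f g : L2 f -> L2 g ->
  mu.-integrable setT (EFin \o (fun x => complex.Re (f x * (g x)^*%C))) /\
  mu.-integrable setT (EFin \o (fun x => complex.Im (f x * (g x)^*%C))).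
Proof.
move=> [mf foo] [mg goo].
have ifg : mu.-integrable setT
    (EFin \o (fun x => normc (f x) ^+ 2 + normc (g x) ^+ 2)).
  have ih h : cmeasurable h -> (sqint h < +oo)%E ->
      mu.-integrable setT (EFin \o (fun x => normc (h x) ^+ 2)).
    move=> mh hoo; apply/integrableP; split.
      exact/measurable_EFinP/measurable_sqr_normc.
    rewrite (eq_integral (fun x => (normc (h x) ^+ 2)%:E))// => x _ /=.
    by rewrite ger0_norm// sqr_ge0.
  rewrite (_ : EFin \o _ = (EFin \o (fun x => normc (f x) ^+ 2)) \+
    (EFin \o (fun x => normc (g x) ^+ 2)))//.
  by apply: integrableD => //; exact: ih.
case: mf mg => [m1 m2] [m3 m4].
split; apply: le_integrable ifg => //.
- apply/measurable_EFinP; rewrite (_ : (fun _ => _) =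
    (fun x => complex.Re (f x) * complex.Re (g x) + complex.Im (f x) * complex.Im (g x))).
    by apply: measurable_funD; exact: measurable_funM.
  by apply/funext => x; case: (f x) => ? ?; case: (g x) => ? ? /=; ring.
- move=> x _ /=; rewrite lee_fin !sqr_normcE.
  rewrite [leRHS]ger0_norm; last by rewrite !addr_ge0// sqr_ge0.
  case: (f x) => a b; case: (g x) => c e /=; rewrite ler_norml.
  have := sqr_ge0 (a - c); have := sqr_ge0 (b - e).
  have := sqr_ge0 (a + c); have := sqr_ge0 (b + e); rewrite !expr2; nra.
- apply/measurable_EFinP; rewrite (_ : (fun _ => _) =
    (fun x => complex.Im (f x) * complex.Re (g x) - complex.Re (f x) * complex.Im (g x))).
    by apply: measurable_funB; exact: measurable_funM.
  by apply/funext => x; case: (f x) => ? ?; case: (g x) => ? ? /=; ring.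
- move=> x _ /=; rewrite lee_fin !sqr_normcE.
  rewrite [leRHS]ger0_norm; last by rewrite !addr_ge0// sqr_ge0.
  case: (f x) => a b; case: (g x) => c e /=; rewrite ler_norml.
  have := sqr_ge0 (a - e); have := sqr_ge0 (b - c).
  have := sqr_ge0 (a + e); have := sqr_ge0 (b + c); rewrite !expr2; nra.
Qed.

Lemma cip_linl (a : R[i]) f g h : L2 f -> L2 g -> L2 h ->
  cip (fun x => a * f x + g x) h = a * cip f h + cip g h.
Proof.
case: a => a b Lf Lg Lh.
have [i1 i2] := L2_integrable_prod Lf Lh.
have [i3 i4] := L2_integrable_prod Lg Lh.
have iZ (k : R) (F : T -> R) : mu.-integrable setT (EFin \o F) ->
    mu.-integrable setT (EFin \o (fun x => k * F x)).
  move=> iF; rewrite (_ : EFin \o _ = fun x => (k%:E * (EFin \o F) x)%E)//.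
  exact: integrableZl.
have iB (F G : T -> R) : mu.-integrable setT (EFin \o F) ->
    mu.-integrable setT (EFin \o G) ->
    mu.-integrable setT (EFin \o (fun x => F x - G x)).
  move=> iF iG; rewrite (_ : EFin \o _ = (EFin \o F) \- (EFin \o G))%E//.
  exact: integrableB.
have iD (F G : T -> R) : mu.-integrable setT (EFin \o F) ->
    mu.-integrable setT (EFin \o G) ->
    mu.-integrable setT (EFin \o (fun x => F x + G x)).
  move=> iF iG; rewrite (_ : EFin \o _ = (EFin \o F) \+ (EFin \o G))%E//.
  exact: integrableD.
rewrite /cip /cintegral; apply/eqP; rewrite eq_complex /=; apply/andP; split.
- rewrite -!RintegralZl// -RintegralB//; [|exact: iZ|exact: iZ].
  rewrite -RintegralD//; last by apply: iB; exact: iZ.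
  apply/eqP/eq_Rintegral => x _.
  by case: (f x) => ? ?; case: (g x) => ? ?; case: (h x) => ? ? /=; ring.
- rewrite -!RintegralZl// -RintegralD//; [|exact: iZ|exact: iZ].
  rewrite -RintegralD//; last by apply: iD; exact: iZ.
  apply/eqP/eq_Rintegral => x _.
  by case: (f x) => ? ?; case: (g x) => ? ?; case: (h x) => ? ? /=; ring.
Qed.

Lemma cip_conj f g : L2 f -> L2 g -> cip f g = (cip g f)^*%C.
Proof.
move=> Lf Lg; have [_ i2] := L2_integrable_prod Lg Lf.
rewrite /cip /cintegral /=; apply/eqP; rewrite eq_complex /=; apply/andP; split.
  apply/eqP/eq_Rintegral => x _.
  by case: (f x) => ? ?; case: (g x) => ? ? /=; ring.
rewrite -mulN1r -RintegralZl//; apply/eqP/eq_Rintegral => x _.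
by case: (f x) => ? ?; case: (g x) => ? ? /=; ring.
Qed.

Lemma cip_self f : L2 f -> cip f f = ((fine (sqint f))%:C)%C.
Proof.
move=> Lf; rewrite /cip /cintegral; apply/eqP; rewrite eq_complex /=.
apply/andP; split; apply/eqP.
  by apply: eq_Rintegral => x _; rewrite sqr_normcE; case: (f x) => ? ? /=; ring.
rewrite /Rintegral integral0_eq// => x _.
by case: (f x) => ? ? /=; congr (_%:E); ring.
Qed.

Lemma cip0l h : cip (cst 0) h = 0.
Proof. by rewrite /cip /cintegral /Rintegral !integral0_eq// => x _; rewrite mul0r. Qed.

Lemma cip_suml n (c : 'I_n -> R[i]) (f : 'I_n -> T -> R[i]) h :
  (forall i, L2 (f i)) -> L2 h ->
  cip (fun x => \sum_(i < n) c i * f i x) h = \sum_(i < n) c i * cip (f i) h.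
Proof.
elim: n => [|n IH] in c f * => Lf Lh.
  by under eq_fun do rewrite big_ord0; rewrite big_ord0; exact: cip0l.
under eq_fun do rewrite big_ord_recl.
by rewrite cip_linl//; [rewrite big_ord_recl IH|exact: L2_sum].
Qed.

Lemma cip_sumr n (c : 'I_n -> R[i]) (f : 'I_n -> T -> R[i]) h :
  (forall i, L2 (f i)) -> L2 h ->
  cip h (fun x => \sum_(i < n) c i * f i x) = \sum_(i < n) (c i)^*%C * cip h (f i).
Proof.
move=> Lf Lh; rewrite cip_conj//; last exact: L2_sum.
rewrite cip_suml// (big_morph _ (rmorphD (@conjc R)) (rmorph0 (@conjc R))).
by apply: eq_bigr => i _; rewrite rmorphM (cip_conj Lh).
Qed.

Lemma cip_sum n (c : 'I_n -> R[i]) (f : 'I_n -> T -> R[i]) : (forall i, L2 (f i)) ->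
  cip (fun x => \sum_(i < n) c i * f i x) (fun x => \sum_(i < n) c i * f i x) =
  \sum_(i < n) \sum_(j < n) c i * ((c j)^*%C * cip (f i) (f j)).
Proof.
move=> Lf; rewrite cip_suml//; last exact: L2_sum.
by apply: eq_bigr => i _; rewrite cip_sumr// mulr_sumr.
Qed.

End square_integrable.

(** The norm of a linear combination depends only on the coefficients and the Gram matrix. The two
    families live on different spaces because this is meant for the [E B u] on R^n and the
    indicators of the sets [B] on the line. *)
Lemma gram_sqint d d' (T : measurableType d) (T' : measurableType d') (R : realType)
    (mu : {measure set T -> \bar R}) (nu : {measure set T' -> \bar R}) n
    (c : 'I_n -> R[i]) (f : 'I_n -> T -> R[i]) (g : 'I_n -> T' -> R[i]) :
  (forall i, L2 mu (f i)) -> (forall i, L2 nu (g i)) ->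
  (forall i j, cip mu (f i) (f j) = cip nu (g i) (g j)) ->
  sqint mu (fun x => \sum_(i < n) c i * f i x) =
  sqint nu (fun x => \sum_(i < n) c i * g i x).
Proof.
move=> Lf Lg fg; rewrite -[LHS]fineK; last exact/fin_sqint/L2_sum.
rewrite -[RHS]fineK; last exact/fin_sqint/L2_sum.
congr (_%:E); apply: complexI; rewrite -!cip_self; [|exact: L2_sum|exact: L2_sum].
by rewrite !cip_sum//; apply: eq_bigr => i _; apply: eq_bigr => j _; rewrite fg.
Qed.

Section completeness.
Context d (T : measurableType d) (R : realType).
Variable mu : {measure set T -> \bar R}.
Local Notation sqint := (sqint mu).

(* The sum [h] of the [4^k |f (k+1) - f k|^2] is integrable, so that almost
   everywhere [f k] converges with error at most [2 sqrt h / 2^k]. *)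
Lemma L2_complete (f : nat -> T -> R[i]) : (forall k, L2 mu (f k)) ->
  (forall k, (sqint (f k.+1 \- f k)%R <= (8 ^- k)%:E)%E) ->
  exists2 g, L2 mu g & sqint (f k \- g) @[k --> \oo] --> 0%E.
Proof.
move=> Lf f8.
have e8 : 8 = 4 * 2 :> R by rewrite -natrM.
have e4 : 2 ^+ 2 = 4 :> R by rewrite -natrX.
pose a k x : R := 4 ^+ k * normc (f k.+1 x - f k x) ^+ 2.
have a0 k x : 0 <= a k x by rewrite mulr_ge0 ?sqr_ge0// exprn_ge0.
have mff k : cmeasurable (f k.+1 \- f k).
  by apply: cmeasurableB; [case: (Lf k.+1)|case: (Lf k)].
have ma k : measurable_fun setT (a k).
  by apply: measurable_funM => //; exact: (measurable_sqr_normc (mff k)).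
pose h x : \bar R := (\sum_(0 <= k <oo) (a k x)%:E)%E.
have h0 x : (0 <= h x)%E by apply: nneseries_ge0 => k _ _; rewrite lee_fin.
have mh : measurable_fun setT h.
  apply: ge0_emeasurable_sum => k //; first by move=> x _ _; rewrite lee_fin.
  by move=> _; exact/measurable_EFinP.
have hoo : (\int[mu]_x h x < +oo)%E.
  rewrite /h integral_nneseries//; first last.
  - by move=> k x _; rewrite lee_fin.
  - by move=> k; exact/measurable_EFinP.
  (* The bound 4^k 8^-k = 2^-k is written [2 / 2 ^ (k + 1)] to fit [cvg_geometric_eseries_half]. *)
  apply: (@le_lt_trans _ _
    (\sum_(0 <= k <oo) (2 / (2 ^ (k + 1))%:R)%:E)%E).
    apply: lee_nneseries => k.
      by move=> *; apply: integral_ge0 => x _; rewrite lee_fin.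
    move=> _; rewrite /a; under eq_integral do rewrite EFinM.
    rewrite ge0_integralZl_EFin//; first last.
    - exact/measurable_EFinP/(measurable_sqr_normc (mff k)).
    - by move=> x _; rewrite lee_fin sqr_ge0.
    apply: (@le_trans _ _ ((4 ^+ k)%:E * (8 ^- k)%:E)%E).
      by apply: lee_wpmul2l => //; exact: f8.
    rewrite -EFinM lee_fin natrX exprD expr1 invfM mulrCA divff ?mulr1//.
    by rewrite e8 exprMn invfM mulrA divff ?mul1r// expf_neq0.
  rewrite (cvg_lim _ (@cvg_geometric_eseries_half R 2 0))//.
  exact: ltry.
pose A := [set x | (h x < +oo)%E].
have mA : measurable A.
  by have := emeasurable_fun_infty_o measurableT mh +oo%E; rewrite setTI.
have ihA : {ae mu, forall x, A x}.
  have : mu.-integrable setT h.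
    by apply/integrableP; split=> //; under eq_integral do rewrite gee0_abs//.
  move=> /(integrable_ae measurableT); apply: filterS => x /(_ I).
  by rewrite ge0_fin_numE.
(* A term of the series is at most its sum, whence |f (k+1) - f k| <= C / 2^k on [A]. Off [A],
   [fine] sends +oo to 0, so that [C] vanishes there. *)
pose C x := Num.sqrt (fine (h x)).
have aC k x : A x -> a k x <= C x ^+ 2.
  move=> Ax; rewrite sqr_sqrtr ?fine_ge0// -lee_fin fineK ?ge0_fin_numE//.
  apply: (@le_trans _ _ (\sum_(0 <= i < k.+1) (a i x)%:E)%E).
    by rewrite big_nat_recr//= leeDr// sume_ge0// => i _; rewrite lee_fin.
  by apply: nneseries_lim_ge => i _ _; rewrite lee_fin.
have CP (y : R) k x : A x -> y ^+ 2 <= normc (f k.+1 x - f k x) ^+ 2 ->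
    `|y * \1_A x| <= C x / 2 ^+ k.
  move=> Ax yf; rewrite indicE mem_set// mulr1.
  rewrite -ler_sqr ?nnegrE ?divr_ge0 ?sqrtr_ge0 ?exprn_ge0//.
  rewrite -normrX ger0_norm ?sqr_ge0// exprMn exprVn -exprM mulnC exprM.
  rewrite ler_pdivlMr ?exprn_gt0// ?exprn_gt0// (le_trans _ (aC k x Ax))//.
  by rewrite mulrC e4 /a ler_wpM2l// exprn_ge0.
have CP' (y : R) k x : y ^+ 2 <= normc (f k.+1 x - f k x) ^+ 2 ->
    `|y * \1_A x| <= C x / 2 ^+ k.
  move=> yf; have [Ax|nAx] := pselect (A x); first exact: CP.
  by rewrite indicE memNset// mulr0 normr0 divr_ge0 ?sqrtr_ge0 ?exprn_ge0.
(* The cut-off by [A] makes the components converge at every point, so that their limits are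
   measurable; it changes [f k] only on a null set. *)
pose F k x := complex.Re (f k x) * \1_A x.
pose G k x := complex.Im (f k x) * \1_A x.
have FP x : cvgn (F ^~ x) /\ forall k, `|limn (F ^~ x) - F k x| <= 2 * C x / 2 ^+ k.
  apply: geometric_cauchy_cvg; first exact: sqrtr_ge0.
  move=> k; rewrite -mulrBl CP'// sqr_normcE.
  by case: (f k.+1 x) (f k x) => [? ?] [? ?] /=; rewrite lerDl sqr_ge0.
have GP x : cvgn (G ^~ x) /\ forall k, `|limn (G ^~ x) - G k x| <= 2 * C x / 2 ^+ k.
  apply: geometric_cauchy_cvg; first exact: sqrtr_ge0.
  move=> k; rewrite -mulrBl CP'// sqr_normcE.
  by case: (f k.+1 x) (f k x) => [? ?] [? ?] /=; rewrite lerDr sqr_ge0.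
have mF k : measurable_fun setT (F k).
  by apply: measurable_funM; [case: (Lf k) => -[]|exact: measurable_indic].
have mG k : measurable_fun setT (G k).
  by apply: measurable_funM; [case: (Lf k) => -[]|exact: measurable_indic].
pose g x := (limn (F ^~ x) +i* limn (G ^~ x))%C.
have mg : cmeasurable g.
  split; rewrite /g /=.
    by apply: (measurable_fun_cvg mF) => x _; case: (FP x).
  by apply: (measurable_fun_cvg mG) => x _; case: (GP x).
pose f' k x := (F k x +i* G k x)%C.
have mf' k : cmeasurable (f' k) by split; [exact: mF|exact: mG].
(* Each component contributes the squared error (2 C / 2^k)^2 = 4 h / 4^k, and there are two of
   them. Off [A] the right side is +oo. *)
have bound k : (sqint (f k \- g)%R <= (8 / 4 ^+ k)%:E * \int[mu]_x h x)%E.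
  have [mfk _] := Lf k.
  rewrite (@sqint_aeq _ _ _ mu _ (f' k \- g)); first last.
  - apply: filterS ihA => x Ax /=; rewrite /f' /F /G indicE mem_set// !mulr1.
    by case: (f k x).
  - exact: cmeasurableB.
  - exact: cmeasurableB.
  rewrite -ge0_integralZl_EFin//.
  apply: ge0_le_integral => //.
  - by move=> x _; rewrite lee_fin sqr_ge0.
  - by apply/measurable_EFinP/measurable_sqr_normc/cmeasurableB.
  - exact: measurable_funeM.
  - move=> x _; have [Ax|nAx] := pselect (A x); last first.
      have -> : h x = +oo%E by apply/eqP; rewrite -leye_eq leNgt; exact/negP.
      by rewrite gt0_muley ?leey// lte_fin divr_gt0// exprn_gt0.
    rewrite -[h x]fineK ?ge0_fin_numE// -EFinM lee_fin sqr_normcE /=.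
    have sq (y z : R) : `|y - z| <= 2 * C x / 2 ^+ k ->
        (z - y) ^+ 2 <= 4 * fine (h x) / 4 ^+ k.
      rewrite -[fine (h x)]sqr_sqrtr ?fine_ge0// -/(C x) => yz.
      have -> : (z - y) ^+ 2 = `|y - z| ^+ 2.
        by rewrite -normrX ger0_norm ?sqr_ge0//; ring.
      apply: (@le_trans _ _ ((2 * C x / 2 ^+ k) ^+ 2)).
        rewrite ler_sqr ?nnegrE// divr_ge0 ?exprn_ge0//.
        by rewrite mulr_ge0// sqrtr_ge0.
      by rewrite !exprMn exprVn -exprM mulnC exprM !e4.
    have := lerD (sq _ _ ((FP x).2 k)) (sq _ _ ((GP x).2 k)).
    move=> /le_trans; apply; rewrite -mulrDl -mulrDl.
    by rewrite mulrAC -natrD.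
exists g.
  have [mf0 f0oo] := Lf 0%N.
  split => //; apply: le_lt_trans (sqint_le2 mu mg mf0) _.
  rewrite lte_add_pinfty// ?lte_mul_pinfty// sqint_subC.
  by apply: le_lt_trans (bound 0%N) _; rewrite lte_mul_pinfty// lee_fin.
pose I := (\int[mu]_x h x)%E.
have Ifin : I \is a fin_num.
  by rewrite ge0_fin_numE// integral_ge0.
apply: (@squeeze_cvge _ _ _ _ (cst 0%E) _
    (fun k => (8 / 4 ^+ k * fine I)%:E)).
- apply: nearW => k; rewrite sqint_ge0 /=.
  by rewrite EFinM fineK.
- exact: cvg_cst.
- apply: cvg_EFin; first exact: nearW.
  rewrite (_ : _ \o _ = geometric (8 * fine I) 4^-1).
    by apply: cvg_geometric; rewrite ger0_norm ?invf_lt1 ?ltr1n.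
  by apply/funext => k /=; rewrite exprVn mulrAC.
Qed.

End completeness.

(** * Spectral measures and the functional calculus *)

Lemma cvge0P {R : realType} (s : nat -> \bar R) : (forall k, (0 <= s k)%E) ->
  (s @ \oo --> 0%E) <->
  (forall e : R, 0 < e -> \forall k \near \oo, (s k <= e%:E)%E).
Proof.
move=> s0; split.
  move=> /fine_cvgP[sfin /cvgrPdist_le se] e e0.
  near=> k; have sk : s k \is a fin_num by near: k.
  rewrite -(fineK sk) lee_fin.
  have : `|0 - fine (s k)| <= e by near: k; exact: se.
  by rewrite sub0r normrN ger0_norm// fine_ge0.
move=> se; apply/fine_cvgP; split.
  by apply: filterS (se _ ltr01) => k sk; rewrite ge0_fin_numE// (le_lt_trans sk)// ltry.
apply/cvgrPdist_le => e e0; apply: filterS (se _ e0) => k sk /=.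
rewrite sub0r normrN ger0_norm ?fine_ge0// -lee_fin fineK//.
by rewrite ge0_fin_numE// (le_lt_trans sk)// ltry.
Unshelve. all: by end_near. Qed.

(** The form in which L^2 limits are taken below: a single index with [s N <= e / c] gives the
    inequality up to [e]. *)
Lemma lee_cvg0 {R : realType} (c : R) (x y : \bar R) (s : nat -> \bar R) : 0 < c ->
  (forall k, (0 <= s k)%E) -> s @ \oo --> 0%E ->
  (forall k, (x <= y + c%:E * s k)%E) -> (x <= y)%E.
Proof.
move=> c0 s0 /(cvge0P s0) sc xy; apply/lee_addgt0Pr => e e0.
have [N _ /(_ N (leqnn N)) /= sN] := sc (e / c) (divr_gt0 e0 c0).
apply: le_trans (xy N) _; apply: leeD => //.
apply: (@le_trans _ _ (c%:E * (e / c)%:E)%E).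
  by apply: lee_wpmul2l => //; rewrite lee_fin ltW.
by rewrite -EFinM lee_fin mulrCA divff ?mulr1// gt_eqF.
Qed.

Section Lp2.
Context {R : realType} {n : nat}.
Implicit Types u v : fn R n.
Local Notation leb := (@lebesgue_tuple R n).

Lemma Lp2E u : Lp 2 u = sqrte (sqint leb u).
Proof.
rewrite /Lp unlock /= poweR12_sqrt; last first.
  by apply: integral_ge0 => x _; rewrite lee_fin powR_ge0.
congr sqrte; apply: eq_integral => x _ /=.
by rewrite powR_mulrn// real_normK// num_real.
Qed.

Lemma sqr_Lp2 u : (Lp 2 u ^+ 2)%E = sqint leb u.
Proof. by rewrite Lp2E sqr_sqrte// sqint_ge0. Qed.

Lemma in_Lp2P u : in_Lp 2 u <-> L2 leb u.
Proof.
have e : (Lp 2 u < +oo)%E = (sqint leb u < +oo)%E.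
  by rewrite Lp2E -!ge0_fin_numE ?sqrte_ge0 ?sqint_ge0// sqrte_fin_num// sqint_ge0.
by split=> [[? ?]|[[? ?]]]; [rewrite e|rewrite -e]; split.
Qed.

Lemma cvg_Lp2P (u_ : nat -> fn R n) u :
  cvg_Lp 2 u_ u <-> sqint leb (u_ k \- u) @[k --> \oo] --> 0%E.
Proof.
rewrite /cvg_Lp; under eq_fun do rewrite Lp2E.
rewrite !cvge0P; [|by move=> k; exact: sqint_ge0|by move=> k; exact: sqrte_ge0].
have lP (e : R) x : 0 < e -> (sqrte x <= e%:E)%E = (x <= (e ^+ 2)%:E)%E.
  by move=> e0; rewrite -[in LHS](gtr0_norm e0) -sqrtr_sqr -[(_)%:E]/(sqrte (_)%:E)
    lee_sqrt// lee_fin sqr_ge0.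
split=> h e e0.
  have s0 : 0 < Num.sqrt e by rewrite sqrtr_gt0.
  by have := h _ s0; apply: filterS => k; rewrite lP// sqr_sqrtr// ltW.
have := h (e ^+ 2) (exprn_gt0 _ e0).
by apply: filterS => k; rewrite lP.
Qed.

End Lp2.

(** * Spectral measures and the isometry on simple functions *)

Section functional_calculus.
Context {R : realType} {n : nat}.
Variable E : @pvm R n.
Implicit Types (u v : fn R n) (A B : set R).
Local Notation leb := (@lebesgue_tuple R n).
Local Notation mu := (pvm_mu E).

Lemma L2_pvm B u : measurable B -> L2 leb u -> L2 leb (E B u).
Proof. by move=> mB /in_Lp2P Lu; apply/in_Lp2P; exact: pvm_L2. Qed.

Lemma pvm_sqint B u : measurable B -> L2 leb u -> mu u B = sqint leb (E B u).
Proof. by move=> mB /in_Lp2P Lu; rewrite pvm_muE// sqr_Lp2. Qed.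

Lemma pvm_muT u : L2 leb u -> mu u setT = sqint leb u.
Proof.
move=> Lu; rewrite pvm_sqint//; apply: sqint_aeq.
- by case: (L2_pvm measurableT Lu).
- by case: Lu.
- by apply: pvm_setT; exact/in_Lp2P.
Qed.

Lemma pvm_mu_le B u : measurable B -> L2 leb u -> (mu u B <= sqint leb u)%E.
Proof. by move=> mB Lu; rewrite -pvm_muT//; apply: le_measure => //; rewrite inE. Qed.

Lemma pvm_mu_lt B u : measurable B -> L2 leb u -> (mu u B < +oo)%E.
Proof. by move=> mB Lu; apply: le_lt_trans (pvm_mu_le mB Lu) _; case: Lu. Qed.

Lemma pvm_mu_lt0 B u : measurable B -> B `<=` [set s | s < 0] -> L2 leb u ->
  mu u B = 0%E.
Proof.
move=> mB B0 Lu; pose I := [set` `]-oo, (0 : R)[].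
have mI : measurable I by exact: measurable_itv.
have e0 : mu u I = 0%E.
  rewrite pvm_sqint// (@sqint_aeq _ _ _ leb _ (cst 0)).
  - by rewrite /sqint integral0_eq// => x _; rewrite normc0 expr0n.
  - by case: (L2_pvm mI Lu).
  - by case: (L2_cst0 leb).
  - by apply: pvm_ge0; exact/in_Lp2P.
apply/eqP; rewrite eq_le measure_ge0 andbT -e0; apply: le_measure; rewrite ?inE//.
Qed.

Lemma pvm_lin B (a : R[i]) u v : measurable B -> L2 leb u -> L2 leb v ->
  aeq (E B (fun x => a * u x + v x)) (fun x => a * E B u x + E B v x).
Proof. by move=> mB /in_Lp2P Lu /in_Lp2P Lv; exact: pvm_linear. Qed.

(** E(B) is a contraction: ||E(B) w||^2 is the mass of [B] for the spectral measure of w, whose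
    total mass is ||w||^2. Linearity allows w = u - v. *)
Lemma sqint_pvmB B u v : measurable B -> L2 leb u -> L2 leb v ->
  (sqint leb (E B u \- E B v)%R <= sqint leb (u \- v)%R)%E.
Proof.
move=> mB Lu Lv; have Luv := L2B Lu Lv.
rewrite (@sqint_aeq _ _ _ leb _ (E B (u \- v))); first by rewrite -pvm_sqint// pvm_mu_le.
- by case: (L2B (L2_pvm mB Lu) (L2_pvm mB Lv)).
- by case: (L2_pvm mB Luv).
rewrite (_ : u \- v = fun x => -1 * v x + u x); last first.
  by apply/funext => x; rewrite mulN1r addrC.
apply: filterS (pvm_lin (-1) mB Lv Lu) => x -> /=.
by rewrite mulN1r addrC.
Qed.

(** Exchanging [u] and [v] gives the other side; together they express the dependence of the mass of
    [B] on the vector well enough to pass to L^2 limits up to a factor 2. *)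
Lemma pvm_mu_le2 B u v : measurable B -> L2 leb u -> L2 leb v ->
  (mu u B <= 2%:E * mu v B + 2%:E * sqint leb (u \- v)%R)%E.
Proof.
move=> mB Lu Lv; rewrite !pvm_sqint//.
have [[mEu _] [mEv _]] := (L2_pvm mB Lu, L2_pvm mB Lv).
apply: le_trans (sqint_le2 leb mEu mEv) _; rewrite leeD//.
by apply: lee_wpmul2l => //; exact: sqint_pvmB.
Qed.

(** By symmetry and multiplicativity, <E(A) u, E(B) u> = <u, E(A) E(B) u> = <u, E(A & B) u>; since
    E(A & B) is idempotent and symmetric, this is ||E(A & B) u||^2, with A & B the intersection. *)
Lemma pvm_gram A B u : measurable A -> measurable B -> L2 leb u ->
  cip leb (E A u) (E B u) = ((fine (mu u (A `&` B)))%:C)%C.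
Proof.
move=> mA mB Lu; have mAB := measurableI A B mA mB.
have iu := (in_Lp2P u).2 Lu.
have iEu C : measurable C -> in_Lp 2 (E C u) by move=> mC; exact: pvm_L2.
(* The product rule for projections holds almost everywhere only, which the inner product does not
   see. *)
have aer f g h : L2 leb f -> L2 leb g -> L2 leb h -> aeq g h ->
    cip leb f g = cip leb f h.
  move=> Lf Lg Lh gh.
  have [i1 i2] := L2_integrable_prod Lf Lg.
  have [i3 i4] := L2_integrable_prod Lf Lh.
  rewrite /cip /cintegral /Rintegral; congr (fine _ +i* fine _)%C.
    apply: ae_eq_integral => //; [exact: measurable_int i1|exact: measurable_int i3|].
    by apply: filterS gh => x ->.
  apply: ae_eq_integral => //; [exact: measurable_int i2|exact: measurable_int i4|].
  by apply: filterS gh => x ->.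
have LE C : measurable C -> L2 leb (E C u) by move=> mC; exact: L2_pvm.
rewrite -[LHS]/(inner (E A u) (E B u)) pvm_sym//; last exact: iEu.
rewrite -[LHS]/(cip leb u (E A (E B u))).
rewrite (aer _ _ (E (A `&` B) u))//; [|exact/L2_pvm/LE|exact: LE|exact: pvm_mul].
rewrite (aer _ _ (E (A `&` B) (E (A `&` B) u)))//; first last.
- have := pvm_mul E mAB mAB iu; rewrite setIid.
  by apply: filterS => x ->.
- exact/L2_pvm/LE.
- exact: LE.
rewrite -[LHS]/(inner u (E (A `&` B) (E (A `&` B) u))) -pvm_sym//; last exact: iEu.
by rewrite -[LHS]/(cip leb _ _) cip_self ?pvm_sqint//; exact: LE.
Qed.

Lemma L2_indic B u : measurable B -> L2 leb u ->
  L2 (mu u) (fun s => ((\1_B s : R)%:C)%C).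
Proof.
move=> mB Lu; split.
  by split; [exact: measurable_indic|exact: measurable_cst].
rewrite /sqint (eq_integral (fun s => (\1_B s)%:E)).
  by rewrite integral_indic// setIT; exact: pvm_mu_lt.
move=> s _; rewrite sqr_normcE /= expr0n addr0 indicE.
by case: (s \in B); rewrite ?expr1n ?expr0n.
Qed.

Lemma indic_gram A B u : measurable A -> measurable B ->
  cip (mu u) (fun s => ((\1_A s : R)%:C)%C) (fun s => ((\1_B s : R)%:C)%C) =
  ((fine (mu u (A `&` B)))%:C)%C.
Proof.
move=> mA mB; rewrite /cip /cintegral; congr (_ +i* _)%C.
  rewrite /Rintegral (eq_integral (fun s => (\1_(A `&` B) s)%:E)).
    by rewrite integral_indic ?setIT//; exact: measurableI.
  by move=> s _ /=; rewrite oppr0 mulr0 subr0 indicI.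
rewrite /Rintegral integral0_eq// => s _ /=.
by rewrite oppr0 mulr0 mul0r addr0.
Qed.

Lemma L2_step_op (c : step) u : L2 leb u -> L2 leb (step_op E c u).
Proof. by move=> Lu; apply: L2_sum => i; apply: L2_pvm => //; exact: step_meas. Qed.

Lemma L2_step_fun (c : step) u : L2 leb u -> L2 (mu u) (step_fun c).
Proof. by move=> Lu; apply: L2_sum => i; apply: L2_indic => //; exact: step_meas. Qed.

(** The sets of a step may overlap. The vectors E(B_i) u and the indicators of the B_i have the same
    Gram matrix, with entries the spectral masses of the intersections of B_i and B_j. *)
Lemma step_isometry (c : step) u : L2 leb u ->
  sqint leb (step_op E c u) = sqint (mu u) (step_fun c).
Proof.
move=> Lu; apply: gram_sqint => [i|i|i j].
- by apply: L2_pvm => //; exact: step_meas.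
- by apply: L2_indic => //; exact: step_meas.
- by rewrite pvm_gram// ?indic_gram//; exact: step_meas.
Qed.

Definition step_restrict B (mB : measurable B) (c : @step R) : step :=
  @Step R (step_len c) (@step_coef R c) (fun i => B `&` step_set i)
    (fun i => measurableI B _ mB (step_meas i)).

(** On each term this is E(B) E(S) = E(B & S); linearity extends it to the sum by induction on the
    number of terms. *)
Lemma step_op_restrict B (mB : measurable B) (c : step) u : L2 leb u ->
  aeq (E B (step_op E c u)) (step_op E (step_restrict mB c) u).
Proof.
move=> Lu; rewrite /step_op /=.
have mS := @step_meas R c; move: (step_len c) (@step_coef R c) (@step_set R c) mS.
(* Linearity with coefficient -1 on the zero function gives E(B) 0 = - E(B) 0 + E(B) 0 = 0, the base
   case. *)
have E0 : aeq (E B (cst 0)) (cst 0).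
  have := pvm_lin (-1) mB (L2_cst0 leb) (L2_cst0 leb).
  rewrite (_ : (fun x => -1 * cst 0 x + _) = cst 0).
    by apply: filterS => x ->; rewrite mulN1r addNr.
  by apply/funext => x /=; rewrite mulr0 addr0.
elim=> [|m IH] a S mS.
  by under eq_fun do rewrite big_ord0; under [X in aeq _ X]eq_fun do rewrite big_ord0.
under eq_fun do rewrite big_ord_recl.
under [X in aeq _ X]eq_fun do rewrite big_ord_recl.
have Ls : L2 leb (fun x => \sum_(i < m) a (lift ord0 i) * E (S (lift ord0 i)) u x).
  by apply: L2_sum => i; exact: L2_pvm.
have h1 := pvm_lin (a ord0) mB (L2_pvm (mS ord0) Lu) Ls.
have h2 := pvm_mul E mB (mS ord0) ((in_Lp2P u).2 Lu).
have h3 := IH (fun i => a (lift ord0 i)) (fun i => S (lift ord0 i)) (fun i => mS _).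
by apply: filterS3 h1 h2 h3 => x -> -> h; congr (_ + _).
Qed.

Lemma step_isometry_restrict B (c : step) u : measurable B -> L2 leb u ->
  sqint leb (E B (step_op E c u)) =
  (\int[mu u]_(s in B) (normc (step_fun c s) ^+ 2)%:E)%E.
Proof.
move=> mB Lu; rewrite (@sqint_aeq _ _ _ leb _ (step_op E (step_restrict mB c) u)).
- rewrite step_isometry// integral_mkcond; apply: eq_integral => s _.
  rewrite /step_fun patchE; case: ifPn => sB.
    congr ((normc _ ^+ 2)%:E); apply: eq_bigr => i _.
    by rewrite /= indicI /= indicE sB mul1r.
  rewrite big1 ?normc0 ?expr0n// => i _ /=.
  by rewrite indicI /= indicE (negbTE sB) mul0r mulr0.
- by case: (L2_pvm mB (L2_step_op c Lu)).
- by case: (L2_step_op (step_restrict mB c) Lu).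
- exact: step_op_restrict.
Qed.

(* The approximating steps give [||E(B)v|| = ||g||_{L^2(B, mu u)}] in the limit;
   two-sided bounds with a constant suffice here and avoid Minkowski. *)
Lemma fcalc_mu (g : R -> R[i]) B u v : cmeasurable g -> measurable B ->
  fcalc E g u v ->
  (mu v B <= 4%:E * \int[mu u]_(s in B) (normc (g s) ^+ 2)%:E)%E /\
  (\int[mu u]_(s in B) (normc (g s) ^+ 2)%:E <= 4%:E * mu v B)%E.
Proof.
move=> mg mB [/in_Lp2P Lu /in_Lp2P Lv [c [cg /cvg_Lp2P cv]]].
rewrite pvm_sqint//.
set I := (\int[mu u]_(s in B) _)%E.
pose r k := sqint (mu u) (step_fun (c k) \- g).
pose q k := sqint leb (step_op E (c k) u \- v).
have rq0 k : (0 <= r k + q k)%E by rewrite adde_ge0// sqint_ge0.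
have rq : (fun k => r k + q k)%E @ \oo --> 0%E by rewrite -[0%E]adde0; exact: cvgeD.
have Lc k := L2_step_op (c k) Lu.
have mc k : cmeasurable (step_fun (c k)) by case: (L2_step_fun (c k) Lu).
have [mEv _] := L2_pvm mB Lv.
have mEc k : cmeasurable (E B (step_op E (c k) u)) by case: (L2_pvm mB (Lc k)).
have e22 (x : \bar R) : (2%:E * (2%:E * x) = 4%:E * x)%E.
  by rewrite muleA -EFinM -natrM.
have D2 (x y : \bar R) : (0 <= x)%E -> (0 <= y)%E ->
    (2%:E * (x + y) = 2%:E * x + 2%:E * y)%E.
  by move=> x0 y0; rewrite ge0_muleDr.
have D4 k : (4%:E * (r k + q k) = 4%:E * r k + 4%:E * q k)%E.
  by rewrite ge0_muleDr// sqint_ge0.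
have le24 (x : \bar R) : (0 <= x)%E -> (2%:E * x <= 4%:E * x)%E.
  by move=> x0; apply: lee_wpmul2r => //; rewrite lee_fin ler_nat.
have I0 : (0 <= I)%E by apply: integral_ge0 => s _; rewrite lee_fin sqr_ge0.
have J0 k : (0 <= \int[mu u]_(s in B) (normc (step_fun (c k) s) ^+ 2)%:E)%E.
  by apply: integral_ge0 => s _; rewrite lee_fin sqr_ge0.
(* Both directions pass through [step_op E (c k) u], using twice an inequality with factor 2. The
   errors are 4 r + 2 q and 2 r + 4 q, both at most 4 (r + q). *)
split; apply: (@lee_cvg0 _ 4 _ _ _ _ rq0 rq) => // k.
- apply: le_trans (sqint_le2 leb mEv (mEc k)) _.
  have h1 := le_sqint (mu u) mB (mc k) mg.
  have h2 := sqint_pvmB mB Lv (Lc k).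
  rewrite step_isometry_restrict// -/(r k) in h1 *.
  rewrite D4 addeA.
  apply: leeD.
    apply: le_trans (lee_wpmul2l _ h1) _ => //.
    rewrite D2 ?mule_ge0 ?sqint_ge0// !e22//.
  apply: le_trans (lee_wpmul2l _ h2) _ => //.
  by rewrite sqint_subC; apply: le24; exact: sqint_ge0.
- apply: le_trans (le_sqint (mu u) mB mg (mc k)) _.
  rewrite -step_isometry_restrict// sqint_subC -/(r k).
  have h1 := sqint_le2 leb (mEc k) mEv.
  have h2 := sqint_pvmB mB (Lc k) Lv.
  rewrite D4 [X in (_ <= _ + X)%E]addeC addeA.
  apply: leeD; last by apply: le24; exact: sqint_ge0.
  apply: le_trans (lee_wpmul2l _ h1) _ => //.
  rewrite D2 ?mule_ge0 ?sqint_ge0// !e22; apply: leeD => //.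
  by apply: lee_wpmul2l.
Qed.

End functional_calculus.

(** The two families are concatenated, with the second coefficients negated. Differences of
    approximants are thus steps, to which the isometry applies. *)
Lemma step_funB {R : realType} (c c' : @step R) : exists2 c'' : step,
  step_fun c'' = step_fun c \- step_fun c' &
  forall n (E : @pvm R n) (u : fn R n),
    step_op E c'' u = step_op E c u \- step_op E c' u.
Proof.
pose a (i : 'I_(step_len c + step_len c')) :=
  match fintype.split i with inl j => step_coef j | inr j => - step_coef j end.
pose S (i : 'I_(step_len c + step_len c')) :=
  match fintype.split i with inl j => step_set j | inr j => step_set j end.
have mS i : measurable (S i) by rewrite /S; case: fintype.split => j; exact: step_meas.
have al j : a (lshift _ j) = step_coef j.
  by rewrite /a -[lshift _ j]/(unsplit (inl j)) unsplitK.
have ar j : a (rshift _ j) = - step_coef j.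
  by rewrite /a -[rshift _ j]/(unsplit (inr j)) unsplitK.
have Sl j : S (lshift _ j) = step_set j.
  by rewrite /S -[lshift _ j]/(unsplit (inl j)) unsplitK.
have Sr j : S (rshift _ j) = step_set j.
  by rewrite /S -[rshift _ j]/(unsplit (inr j)) unsplitK.
exists (@Step R _ a S mS) => [|n E u]; apply/funext => x.
  rewrite /step_fun /= big_split_ord /= -sumrN; congr (_ + _).
    by apply: eq_bigr => j _; rewrite al Sl.
  by apply: eq_bigr => j _; rewrite ar Sr mulNr.
rewrite /step_op /= big_split_ord /= -sumrN; congr (_ + _).
  by apply: eq_bigr => j _; rewrite al Sl.
by apply: eq_bigr => j _; rewrite ar Sr mulNr.
Qed.

Import HBNNSimple.

(** The sets are the fibres of [h] over the enumeration [r] of its finite range, and the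
    coefficients are the values. *)
Lemma step_of_nnsfun {R : realType} (h : {nnsfun R >-> R}) :
  exists c : step, step_fun c = fun s => ((h s)%:C)%C.
Proof.
pose r := finmap.enum_fset (fset_set (range h)).
pose S (i : 'I_(size r)) : set R := h @^-1` [set r`_i].
have mS i : measurable (S i) by exact: (measurable_funPTI h (measurable_set1 _)).
exists (@Step R _ (fun i => ((r`_i)%:C)%C) S mS); apply/funext => s.
rewrite /step_fun /= [in RHS]fimfunE fsbig_finite//= -/r.
rewrite (big_nth 0) big_mkord.
rewrite (big_morph _ (rmorphD (real_complex R)) (rmorph0 (real_complex R))).
by apply: eq_bigr => i _; rewrite rmorphM.
Qed.

(** * Vectors in the domain of a function of the operator *)

Section existence.
Context {R : realType} {n : nat}.
Variable E : @pvm R n.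
Local Notation leb := (@lebesgue_tuple R n).
Local Notation mu := (pvm_mu E).

(** Simple functions a_k increase to [h]; since 0 <= a_k <= h, the squared error is dominated by the
    integrable h^2 and dominated convergence applies. *)
Lemma step_dense (nu : {measure set R -> \bar R}) (h : R -> R) (e : R) :
  measurable_fun setT h -> (forall s, 0 <= h s) ->
  (\int[nu]_s (h s ^+ 2)%:E < +oo)%E -> 0 < e ->
  exists c : step, (sqint nu (step_fun c \- (fun s => ((h s)%:C)%C))%R <= e%:E)%E.
Proof.
move=> mh h0 hoo e0.
have mh' : measurable_fun setT (EFin \o h).
  exact/measurable_EFinP.
pose a := nnsfun_approx measurableT mh'.
have ac s : (fun m => a m s) @ \oo --> h s.
  have := @cvg_nnsfun_approx _ _ _ _ measurableT _ mh' (fun s _ => h0 s) s Logic.I.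
  by move/fine_cvgP => [_].
have ah k s : a k s <= h s.
  have nd : {homo (fun m => a m s) : m1 m2 / (m1 <= m2)%N >-> m1 <= m2}.
    by move=> m1 m2 /(nd_nnsfun_approx measurableT mh')/lefP/(_ s).
  rewrite -(cvg_lim _ (ac s))//; apply: nondecreasing_cvgn_le => //.
  by apply/cvg_ex; exists (h s); exact: ac.
have a0 k s : 0 <= a k s by [].
have ma k : measurable_fun setT (a k) by exact: measurable_funPT.
have mh2 : measurable_fun setT (fun s => (h s ^+ 2)%:E).
  by apply/measurable_EFinP; exact: measurable_funX.
have : (\int[nu]_s ((a k s - h s) ^+ 2)%:E)%E @[k --> \oo] --> (\int[nu]_s cst 0 s)%E.
  apply: (@dominated_cvg _ _ _ nu _ measurableT _ _ (fun s => (h s ^+ 2)%:E)) => //.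
  - move=> k; apply/measurable_EFinP; apply: measurable_funX.
    exact: measurable_funB.
  - move=> s _; apply: cvg_EFin; first exact: nearW.
    rewrite (_ : 0 = (h s - h s) ^+ 2); last by rewrite subrr expr0n.
    have ahs : (fun k => a k s - h s) @ \oo --> h s - h s.
      by apply: cvgB; [exact: ac|exact: cvg_cst].
    rewrite expr2 (_ : _ \o _ = (fun k => (a k s - h s) * (a k s - h s))).
      exact: cvgM.
    by apply/funext => k /=; rewrite expr2.
  - apply/integrableP; split => //.
    by under eq_integral do rewrite gee0_abs ?lee_fin ?sqr_ge0//.
  - move=> k s _; rewrite /= lee_fin ger0_norm ?sqr_ge0//.
    have := ah k s; have := a0 k s; rewrite !expr2; nra.
rewrite integral0 cvge0P; last first.
  by move=> k; apply: integral_ge0 => s _; rewrite lee_fin sqr_ge0.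
move=> /(_ e e0)[N _ /(_ N (leqnn N)) aN].
have [c cE] := step_of_nnsfun (a N); exists c; rewrite cE.
rewrite /sqint (eq_integral (fun s => ((a N s - h s) ^+ 2)%:E))// => s _.
by rewrite sqr_normcE /= subr0 expr0n addr0.
Qed.

(** Steps converging to [h] in L^2 of the spectral measure are Cauchy, and by the isometry so are
    the corresponding vectors; their limit is [v]. *)
Lemma fcalc_exists (h : R -> R) u : measurable_fun setT h -> (forall s, 0 <= h s) ->
  L2 leb u -> (\int[mu u]_s (h s ^+ 2)%:E < +oo)%E ->
  exists v, fcalc E (fun s => ((h s)%:C)%C) u v.
Proof.
move=> mh h0 Lu hoo; pose g s := ((h s)%:C)%C.
have mg : cmeasurable g by split => //; exact: measurable_cst.
(* The error 8^-k / 4 makes consecutive approximants differ by at most 2 (8^-k / 4) + 2 (8^-k / 4) =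
   8^-k, the rate that [L2_complete] asks for. *)
have /choice[c cP] k : exists c : step,
    (sqint (mu u) (step_fun c \- g)%R <= (8 ^- k / 4)%:E)%E.
  by apply: step_dense => //; rewrite divr_gt0// invr_gt0 exprn_gt0.
have Lc k := L2_step_op E (c k) Lu.
have mc k : cmeasurable (step_fun (c k)) by case: (L2_step_fun E (c k) Lu).
have fast k : (sqint leb (step_op E (c k.+1) u \- step_op E (c k) u)%R <= (8 ^- k)%:E)%E.
  have [d dE dop] := step_funB (c k.+1) (c k).
  rewrite -dop step_isometry// dE.
  apply: le_trans (sqint_le2 (mu u) (cmeasurableB (mc k.+1) (mc k))
    (cmeasurableB (mc k.+1) mg)) _.
  rewrite (_ : _ \- _ \- _ = g \- step_fun (c k)); last first.
    by apply/funext => s /=; ring.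
  apply: (@le_trans _ _ (2%:E * (8 ^- k / 4)%:E + 2%:E * (8 ^- k / 4)%:E)%E).
    apply: leeD; apply: lee_wpmul2l => //; last by rewrite sqint_subC.
    apply: le_trans (cP k.+1) _; rewrite lee_fin ler_wpM2r//.
    by rewrite lef_pV2 ?posrE ?exprn_gt0// ler_eXn2l// ltr1n.
  rewrite -!EFinM -EFinD lee_fin.
  by have : 0 <= 8 ^- k :> R; [rewrite invr_ge0 exprn_ge0|lra].
have [v Lv cv] := L2_complete Lc fast.
exists v; split; [exact/in_Lp2P|exact/in_Lp2P|exists c; split].
  have s0 k : (0 <= sqint (mu u) (step_fun (c k) \- g)%R)%E by exact: sqint_ge0.
  rewrite -[X in X @ _ --> _]/(fun k => sqint (mu u) (step_fun (c k) \- g)).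
  apply: (@squeeze_cvge _ _ _ _ (cst 0%E) _ (fun k => (8 ^- k / 4)%:E)).
  - by apply: nearW => k; rewrite s0 cP.
  - exact: cvg_cst.
  - apply: cvg_EFin; first exact: nearW.
    rewrite (_ : _ \o _ = geometric 4^-1 8^-1).
      by apply: cvg_geometric; rewrite ger0_norm ?invf_lt1 ?ltr1n.
    by apply/funext => k /=; rewrite exprVn mulrC.
exact/cvg_Lp2P.
Qed.

End existence.

(** * The energy space *)

(** On a slice, 1 + s lies between j + 1 and j + 2 <= 2 (j + 1), hence is constant up to a factor 2.
    Half-open slices partition the half-line. *)
Definition unit_slice {R : realType} (j : nat) : set R := [set s | j%:R <= s < j.+1%:R].

Definition nonneg_line {R : realType} : set R := [set s | 0 <= s].

Section slices.
Context {R : realType}.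
Local Notation slice := (@unit_slice R).
Local Notation half := (@nonneg_line R).

Lemma measurable_unit_slice j : measurable (slice j).
Proof.
rewrite (_ : slice j = [set` `[j%:R, j.+1%:R[]); first exact: measurable_itv.
by apply/seteqP; split => s; rewrite /= in_itv.
Qed.

Lemma measurable_nonneg_line : measurable half.
Proof.
rewrite (_ : half = [set` `[0, +oo[]); first exact: measurable_itv.
by apply/seteqP; split => s; rewrite /= in_itv /= andbT.
Qed.

Lemma bigcup_unit_slice : \bigcup_j slice j = half.
Proof.
apply/seteqP; split => [s [j _ /andP[js _]]|s s0].
  exact: le_trans js.
by exists (Num.truncn s) => //; exact: truncn_itv.
Qed.

Lemma trivIset_unit_slice : trivIset setT slice.
Proof.
move=> i j _ _ [s [/andP[ls si] /andP[js sj]]]; apply/eqP.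
rewrite eqn_leq -[(i <= j)%N]ltnS -[(j <= i)%N]ltnS.
by rewrite -!(ltr_nat R) (le_lt_trans ls sj) (le_lt_trans js si).
Qed.

(** The measures on the two sides differ, so no pointwise comparison of [f] and [g] is possible; the
    slices are compared one by one and summed by countable additivity. *)
Lemma integral_slices_le (mu nu : {measure set R -> \bar R}) (f g : R -> \bar R) (c : R) :
  0 <= c -> measurable_fun half f -> measurable_fun half g ->
  (forall s, half s -> (0 <= f s)%E) -> (forall s, half s -> (0 <= g s)%E) ->
  (forall j, (\int[mu]_(s in slice j) f s <= c%:E * \int[nu]_(s in slice j) g s)%E) ->
  (\int[mu]_(s in half) f s <= c%:E * \int[nu]_(s in half) g s)%E.
Proof.
move=> c0 mf mg f0 g0 fg.
have sub j : slice j `<=` half by rewrite -bigcup_unit_slice; exact: bigcup_sup.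
rewrite -bigcup_unit_slice !ge0_integral_bigcup ?bigcup_unit_slice//; first last.
- exact: trivIset_unit_slice.
- exact: measurable_unit_slice.
- exact: trivIset_unit_slice.
- exact: measurable_unit_slice.
rewrite -nneseriesZl; last first.
  by move=> j _; apply: integral_ge0 => s /sub; exact: g0.
by apply: lee_nneseries => // j _ _; apply: integral_ge0 => s /sub; exact: f0.
Qed.

End slices.

Section energy_space.
Context {R : realType} {n : nat}.
Variable lam : R.
Implicit Types u v w : fn R n.
Local Notation leb := (@lebesgue_tuple R n).
Local Notation E := (spectral (@Kop R n lam)).
Local Notation mu := (pvm_mu E).
Local Notation half := (@nonneg_line R).

Lemma measurable_sqrtr : measurable_fun setT (fun s : R => Num.sqrt s).
Proof. by apply: continuous_measurable_fun; exact: sqrt_continuous. Qed.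

(** The multiplier has squared modulus 1 + s, which lies in [a + 1, a + 2] on [B]; the factor 4 is
    that of [fcalc_mu]. *)
Lemma bracketK_mu B u v (a : R) : measurable B -> 0 <= a ->
  (forall s, B s -> a <= s <= a + 1) -> bracketK lam u v ->
  (mu v B <= (4 * (a + 2))%:E * mu u B)%E /\
  ((a + 1)%:E * mu u B <= 4%:E * mu v B)%E.
Proof.
move=> mB a0 Ba uv.
pose g (s : R) : R[i] := ((Num.sqrt (1 + s))%:C)%C.
have mg : cmeasurable g.
  split; last exact: measurable_cst.
  apply: (measurableT_comp measurable_sqrtr).
  exact: measurable_funD.
have g2 s : B s -> normc (g s) ^+ 2 = 1 + s.
  move=> /Ba/andP[as_ _]; rewrite sqr_normcE /= expr0n addr0 sqr_sqrtr//.
  by rewrite addr_ge0// (le_trans a0).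
have mg2 : measurable_fun B (fun s => (normc (g s) ^+ 2)%:E).
  by apply/measurable_EFinP/measurable_funTS; exact: measurable_sqr_normc.
have [h1 h2] := fcalc_mu mg mB uv.
split.
  apply: le_trans h1 _; rewrite EFinM -muleA; apply: lee_wpmul2l => //.
  rewrite -integral_cst//; apply: ge0_le_integral => //.
  - by move=> s _; rewrite lee_fin sqr_ge0.
  - by move=> s Bs; rewrite lee_fin g2//; have := Ba _ Bs; lra.
apply: le_trans h2; rewrite -integral_cst//; apply: ge0_le_integral => //.
- by move=> s _; rewrite lee_fin addr_ge0.
- by move=> s Bs; rewrite lee_fin g2//; have := Ba _ Bs; lra.
Qed.

(* [16 = 2 * 4 * 2]: [bracketK_mu] between two passages to the L^2 limit. *)
Lemma W_graph_mu B u v (a : R) : measurable B -> 0 <= a ->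
  (forall s, B s -> a <= s <= a + 1) -> W_graph lam 2 u v ->
  (mu v B <= (16 * (a + 2))%:E * mu u B)%E /\
  ((a + 1)%:E * mu u B <= 16%:E * mu v B)%E.
Proof.
move=> mB a0 Ba [/in_Lp2P Lu /in_Lp2P Lv [phi [psi [pP /cvg_Lp2P cu /cvg_Lp2P cv]]]].
have Lphi k : L2 leb (phi k) by have [_ [/in_Lp2P]] := pP k.
have Lpsi k : L2 leb (psi k) by have [_ _ /in_Lp2P] := pP k.
have bk k : bracketK lam (phi k) (psi k) by have [] := pP k.
pose r k := sqint leb (phi k \- u).
pose q k := sqint leb (psi k \- v).
have r0 k : (0 <= r k)%E by exact: sqint_ge0.
have q0 k : (0 <= q k)%E by exact: sqint_ge0.
have rq0 k : (0 <= r k + q k)%E by rewrite adde_ge0.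
have rq : (fun k => r k + q k)%E @ \oo --> 0%E by rewrite -[0%E]adde0; exact: cvgeD.
have a2 : 0 <= a + 2 by rewrite addr_ge0.
have a1 : 0 <= a + 1 by rewrite addr_ge0.
pose m (w : fn R n) : R := fine (mu w B).
have mE w : L2 leb w -> mu w B = (m w)%:E.
  by move=> Lw; rewrite fineK// ge0_fin_numE// pvm_mu_lt.
have LB f g : L2 leb f -> L2 leb g -> exists2 x : R, 0 <= x &
    sqint leb (f \- g)%R = x%:E.
  move=> Lf Lg; exists (fine (sqint leb (f \- g))); first by rewrite fine_ge0// sqint_ge0.
  by rewrite fineK//; exact/fin_sqint/L2B.
(* With x and y the values of [r k] and [q k], the two chains end with errors
   [16 * (a + 2) * x + 2 * y] and [2 * (a + 1) * x + 16 * y]; this constant dominates all four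
   coefficients. *)
have c16 : 0 < 16 * (a + 2) by rewrite mulr_gt0// ltr_wpDl.
split; apply: (@lee_cvg0 _ (16 * (a + 2)) _ _ _ c16 rq0 rq) => k.
- have h1 := pvm_mu_le2 E mB Lv (Lpsi k).
  have [h2 _] := bracketK_mu mB a0 Ba (bk k).
  have h3 := pvm_mu_le2 E mB (Lphi k) Lu.
  move: h1 h2 h3; rewrite sqint_subC /r /q.
  have [x x0 ->] := LB _ _ (Lphi k) Lu; have [y y0 ->] := LB _ _ (Lpsi k) Lv.
  rewrite !mE// -!EFinM -!EFinD !lee_fin => h1 h2 h3.
  apply: le_trans h1 _.
  have : (4 * (a + 2)) * m (phi k) <= (4 * (a + 2)) * (2 * m u + 2 * x).
    by apply: ler_wpM2l => //; rewrite mulr_ge0.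
  have : 0 <= (a + 2) * x by rewrite mulr_ge0.
  have : 2 * y <= (a + 2) * y by rewrite ler_wpM2r// lerDr.
  nra.
- have h1 := pvm_mu_le2 E mB Lu (Lphi k).
  have [_ h2] := bracketK_mu mB a0 Ba (bk k).
  have h3 := pvm_mu_le2 E mB (Lpsi k) Lv.
  move: h1 h2 h3; rewrite sqint_subC /r /q.
  have [x x0 ->] := LB _ _ (Lphi k) Lu; have [y y0 ->] := LB _ _ (Lpsi k) Lv.
  rewrite !mE// -!EFinM -!EFinD !lee_fin => h1 h2 h3.
  have := ler_wpM2l a1 h1.
  have : 0 <= a * x by rewrite mulr_ge0.
  have : 2 * y <= (a + 2) * y by rewrite ler_wpM2r// lerDr.
  nra.
Qed.

(** The H^1 norm, defined by closure of test functions, is here equivalent to the spectral one: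
    [W_graph_mu] with a = j on each slice, then summation. *)
Lemma W_graph_norm u v : W_graph lam 2 u v ->
  (sqint leb v <= 32%:E * \int[mu u]_(s in half) (1 + s)%:E)%E /\
  (\int[mu u]_(s in half) (1 + s)%:E <= 32%:E * sqint leb v)%E.
Proof.
move=> uv; have [/in_Lp2P Lu /in_Lp2P Lv _] := uv.
have mh := @measurable_nonneg_line R.
have m1 : measurable_fun setT (fun s : R => (1 + s)%:E).
  by apply/measurable_EFinP; exact: measurable_funD.
have sl j s : @unit_slice R j s -> j%:R <= s <= j%:R + 1.
  by move=> /andP[js sj]; rewrite js natr1 ltW.
have slP j := W_graph_mu (@measurable_unit_slice R j) (ler0n R j) (sl j) uv.
(* Since the negative axis carries no spectral mass, ||v||^2 is the integral of 1 over the
   half-line, a form that can be sliced. *)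
have ve : sqint leb v = (\int[mu v]_(s in half) cst 1 s)%E.
  rewrite integral_cst// mul1e -(pvm_muT E Lv) -(setUv half) measureU//; first last.
  - by rewrite setICr.
  - exact: measurableC.
  rewrite [X in (_ + X)%E](_ : _ = 0%E) ?adde0//.
  apply: pvm_mu_lt0 => //; first exact: measurableC.
  by move=> s /= /negP; rewrite -ltNge.
rewrite ve; split; apply: integral_slices_le => //.
- exact: measurable_funTS.
- by move=> s s0; rewrite lee_fin addr_ge0.
- move=> j; have [h _] := slP j.
  rewrite integral_cst ?mul1e; last exact: measurable_unit_slice.
  apply: le_trans h _.
  (* The factor j / 2 + 1 is at most 1 + s on the slice, where s >= j. *)
  rewrite (_ : 16 * (j%:R + 2) = 32 * (j%:R / 2 + 1)); last by field.
  rewrite EFinM -muleA; apply: lee_wpmul2l => //.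
  rewrite -integral_cst; last exact: measurable_unit_slice.
  apply: ge0_le_integral; first exact: measurable_unit_slice.
  - by move=> s _; rewrite lee_fin addr_ge0// divr_ge0.
  - exact: measurable_cst.
  - exact: measurable_funTS.
  - by move=> s /sl; rewrite lee_fin; have := ler0n R j; lra.
- exact: measurable_funTS.
- by move=> s s0; rewrite lee_fin addr_ge0.
- move=> j; have [_ h] := slP j.
  rewrite integral_cst ?mul1e; last exact: measurable_unit_slice.
  (* On the slice 1 + s <= 2 (j + 1), and 2 times the 16 of [W_graph_mu] is 32. *)
  apply: (@le_trans _ _ (2%:E * ((j%:R + 1)%:E * mu u (unit_slice j)))%E).
    rewrite muleA -EFinM -integral_cst; last exact: measurable_unit_slice.
    apply: ge0_le_integral; first exact: measurable_unit_slice.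
    - by move=> s /sl; rewrite lee_fin; have := ler0n R j; lra.
    - exact: measurable_funTS.
    - exact: measurable_cst.
    - by move=> s /sl; rewrite lee_fin; have := ler0n R j; lra.
  apply: le_trans (lee_wpmul2l _ h) _ => //.
  by rewrite muleA -EFinM -natrM.
Qed.

Lemma sqrtK_mu u w : sqrtK lam u w ->
  (\int[mu u]_(s in half) s%:E <= 4%:E * sqint leb w)%E.
Proof.
move=> uw; have [/in_Lp2P Lu /in_Lp2P Lw _] := uw.
have mh := @measurable_nonneg_line R.
have mg : cmeasurable (fun s : R => ((Num.sqrt s)%:C)%C).
  by split; [exact: measurable_sqrtr|exact: measurable_cst].
have [_ h] := fcalc_mu mg mh uw.
apply: le_trans (lee_wpmul2l _ (pvm_mu_le E mh Lw)) => //.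
apply: le_trans h; rewrite le_eqVlt; apply/orP; left; apply/eqP.
apply: eq_integral => s; rewrite inE => s0.
by rewrite sqr_normcE /= expr0n addr0 sqr_sqrtr.
Qed.

(** The integral of 1 + s is finite by [W_graph_norm] and dominates that of the squared root, which
    is s on the half-line and 0 on the negative axis, where [Num.sqrt] vanishes. *)
Lemma H1_sqrtK u : in_H1 lam u -> exists w, sqrtK lam u w.
Proof.
move=> [v uv]; have [/in_Lp2P Lu /in_Lp2P Lv _] := uv.
have [_ h] := W_graph_norm uv.
have mh := @measurable_nonneg_line R.
apply: fcalc_exists => //; first exact: measurable_sqrtr.
apply: (@le_lt_trans _ _ (32%:E * sqint leb v)%E); last first.
  by rewrite lte_mul_pinfty//; case: Lv.
apply: le_trans h; rewrite [leRHS]integral_mkcond; apply: ge0_le_integral => //.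
- by apply/measurable_EFinP; apply: measurable_funX; exact: measurable_sqrtr.
- apply/(measurable_restrictT _ _).1 => //; apply/measurable_EFinP.
  by apply: measurable_funTS; exact: measurable_funD.
- move=> s _; rewrite patchE; case: ifPn => sh.
    by move: sh; rewrite inE /nonneg_line /= => s0; rewrite lee_fin sqr_sqrtr// lerDr.
  rewrite lee_fin ler0_sqrtr ?expr0n// ltW// ltNge.
  by apply: contra sh => s0; rewrite inE.
Qed.

(** In the integral of 1 + s, the term 1 gives at most the mass of [u] and the term s is controlled
    by [sqrtK_mu]. *)
Lemma H1_norm_le u w : in_H1 lam u -> sqrtK lam u w ->
  (H1_norm lam u <= sqrte (32%:E * (sqint leb u + 4%:E * sqint leb w)))%E.
Proof.
case=> v uv uw; have [/in_Lp2P Lu ? ?] := uv.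
have [h _] := W_graph_norm uv.
have mh := @measurable_nonneg_line R.
apply: (@le_trans _ _ (Lp 2 v)); first by apply: ereal_inf_lbound; exists v.
rewrite Lp2E lee_sqrt; last by rewrite mule_ge0// adde_ge0 ?mule_ge0 ?sqint_ge0.
apply: le_trans h _; apply: lee_wpmul2l => //.
under eq_integral do rewrite EFinD.
rewrite ge0_integralD//.
rewrite integral_cst// mul1e; apply: leeD; first exact: pvm_mu_le.
exact: sqrtK_mu.
Qed.

End energy_space.

(** * Potential energy *)

Section potential_energy.
Context {R : realType} {n : nat}.
Variables (alpha tau p : R).
Implicit Types u : fn R n.

Lemma riesz_ge0 (x : n.-tuple R) : 0 <= riesz alpha x.
Proof.
have G0 (s : R) : 0 <= Gamma s.
  by apply: Rintegral_ge0 => t _; rewrite mulr_ge0 ?powR_ge0// expR_ge0.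
by rewrite mulr_ge0 ?powR_ge0// divr_ge0// !mulr_ge0// powR_ge0.
Qed.

Lemma Pfunctional_ge0 u : (0 <= Pfunctional alpha tau p u)%E.
Proof.
apply: integral_ge0 => x _; rewrite !mule_ge0 ?lee_fin ?powR_ge0//.
apply: integral_ge0 => y _; rewrite lee_fin mulr_ge0 ?riesz_ge0//.
by rewrite mulr_ge0 ?powR_ge0.
Qed.

(** Turns the absolute convergence contained in [elliptic], tested with the solution itself, into
    finiteness of its potential energy. *)
Lemma abs_pairing_self u : 1 < p ->
  abs_pairing alpha tau p u u = Pfunctional alpha tau p u.
Proof.
move=> p1; apply: eq_integral => x _.
rewrite EFinM -!muleA; congr (_ * _)%E.
rewrite muleCA; congr (_ * _)%E.
have c0 : 0 <= normc (u x) by case: (u x) => ? ?; exact: sqrtr_ge0.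
rewrite -EFinM -{2}(powRr1 c0) -powRD ?subrK//.
by rewrite gt_eqF// (lt_trans ltr01 p1).
Qed.

End potential_energy.

(** * A priori bound on the kinetic energy, and conclusion *)

Lemma sqrtK_norm_ge0 {R : realType} n (lam : R) (u : fn R n) : (0 <= sqrtK_norm lam u)%E.
Proof. by apply: le_ereal_inf_tmp => _ [w _ <-]; exact: Lnorm_ge0. Qed.

(** For y = 0 the inverse is +oo, so a quotient below 1 forces x = 0. *)
Lemma lee_of_div_lt1 {R : realType} (x y : \bar R) :
  (0 <= x)%E -> (0 <= y < +oo)%E -> (x / y < 1)%E -> (x <= y)%E.
Proof.
move=> x0 /andP[]; rewrite le_eqVlt => /predU1P[<- _|y0 yoo].
  rewrite inve0 leNgt; apply: contraL => x1.
  by rewrite gt0_muley// -leNgt leey.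
case: y y0 yoo => // y y0 _; rewrite lte_fin in y0.
rewrite inver gt_eqF// => xy; rewrite leNgt; apply/negP => yx.
move: xy; rewrite ltNge => /negP; apply.
apply: (@le_trans _ _ (y%:E * (y^-1)%:E)%E).
  by rewrite -EFinM divff// gt_eqF.
by apply: lee_wpmul2r; [rewrite lee_fin invr_ge0 ltW|exact: ltW].
Qed.

(** Read [k] as ||sqrt K u(t)||, [P] as the potential energy, [P0] as that of the ground state, [e]
    as the conserved energy and [c] as the exponent: then k^2 = e + P / c <= e + P0 / c. *)
Lemma kinetic_bound {R : realType} {I : Type} (D : set I) (k P : I -> \bar R)
    (P0 e : \bar R) (c : R) : 0 < c ->
  (forall i, (0 <= P i)%E) -> (0 <= P0 < +oo)%E -> (e < +oo)%E ->
  (forall i, D i -> (k i ^+ 2 - c^-1%:E * P i)%E = e) ->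
  (ereal_sup [set P i / P0 | i in D] < 1)%E ->
  exists2 M : R, 0 <= M & forall i, D i -> (k i < M%:E)%E.
Proof.
move=> c0 Pge0 /andP[P00 P0oo] eoo ke Psup.
have c'0 : 0 <= c^-1 by rewrite invr_ge0 ltW.
have P0fin : P0 \is a fin_num by rewrite ge0_fin_numE.
(* Only an upper bound on the energy is at hand, so -oo is replaced by a real majorant. *)
have [e0 e0E] : exists e0 : R, (e <= e0%:E)%E.
  by case: e eoo {ke} => [r| |] // _; [exists r|exists 0; exact: leNye].
pose K := e0 + c^-1 * fine P0.
have kK i : D i -> (k i ^+ 2 <= K%:E)%E.
  move=> Di; have Pi : (P i <= P0)%E.
    apply: lee_of_div_lt1 => //; first by rewrite P00.
    by apply: le_lt_trans Psup; apply: ereal_sup_ubound; exists i.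
  have Pfin : P i \is a fin_num by rewrite ge0_fin_numE// (le_lt_trans Pi).
  move: e0E; rewrite -(ke i Di) leeBlDr; last by rewrite fin_numM.
  move=> /le_trans; apply; rewrite EFinD EFinM fineK//; apply: leeD => //.
  exact: lee_wpmul2l.
have sK := sqrtr_ge0 K.
(* Adding 1 makes the bound strict, so that an infimum below it is beaten by an actual element. *)
exists (Num.sqrt K + 1) => [|i Di]; first by rewrite addr_ge0.
have K0 : 0 <= K by rewrite -lee_fin (le_trans (sqre_ge0 _) (kK i Di)).
apply: lte_sqrE; first by rewrite lee_fin addr_ge0.
apply: le_lt_trans (kK i Di) _; rewrite -EFin_expe lte_fin sqrrD sqr_sqrtr//.
by rewrite expr1n mulr1 -addrA ltrDl ltr_wpDl// mulrn_wge0.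
Qed.

(** In the focusing energy the nonnegative potential part is subtracted, so the kinetic part is an
    upper bound. *)
Lemma energy_lty {R : realType} n (lam alpha tau p : R) (u w : fn R n) : 0 < p ->
  sqrtK lam u w -> (energy lam alpha tau p u < +oo)%E.
Proof.
move=> p0 uw; have kw : (sqrtK_norm lam u < +oo)%E.
  apply: (@le_lt_trans _ _ (Lp 2 w)); first by apply: ereal_inf_lbound; exists w.
  by case: uw => _ [].
rewrite /energy; have := sqrtK_norm_ge0 lam u; have := Pfunctional_ge0 alpha tau p u.
move: (sqrtK_norm lam u) kw (Pfunctional _ _ _ _) => k koo P P0 k0.
apply: (@le_lt_trans _ _ (k ^+ 2)%E).
  by rewrite -[leRHS]sube0 leeB// mule_ge0// lee_fin invr_ge0 ltW.
have kfin : k \is a fin_num by rewrite ge0_fin_numE.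
by rewrite -(fineK kfin) -EFin_expe ltry.
Qed.

Theorem proposition1p9 (R : realType) (n : nat) (lam alpha tau p : R)
    (phi u0 : fn R n) (u : R -> fn R n) (Tmax : \bar R) :
  (3 <= n)%N ->
  - ((n%:R - 2) ^+ 2 / 4) < lam ->
  0 < alpha < n%:R ->
  2 * kappa n lam < n%:R - 2
    - 2 * (n%:R - 2)
      / (3 * n%:R - 2 + 2 * Num.sqrt (9 * n%:R ^+ 2 + 8 * n%:R - 16)) ->
  alpha / 2 - (n%:R + 2 + Num.sqrt (9 * n%:R ^+ 2 + 8 * n%:R - 16)) / 2 < tau ->
  tau < alpha / 2
    - Num.max ((n%:R - 4) / 2)
        (Num.max ((n%:R - 4) / n%:R)
           (kappa n lam / (n%:R - 2 - 2 * kappa n lam) - n%:R / 4)) ->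
  p = 1 + (2 - 2 * tau + alpha) / (n%:R - 2) ->
  2 < p ->
  ground_state lam alpha tau p phi ->
  (0 < Tmax)%E ->
  in_H1 lam u0 ->
  maximal_solution lam alpha tau p Tmax u0 u ->
  (ereal_sup [set Pfunctional alpha tau p (u t) / Pfunctional alpha tau p phi
             | t in forward Tmax] < 1)%E ->
  (ereal_sup [set H1_norm lam (u t) | t in forward Tmax] < +oo)%E.
Proof.
move=> _ _ _ _ _ _ _ p2 [phiH1 _ [f fphi phiE] _] _ u0H1 [[_ uCH1 _ mass ener] _] Psup.
have p1 : 1 < p by apply: lt_trans p2; rewrite ltr1n.
have p0 : 0 < p := lt_trans ltr01 p1.
have Pphi : (0 <= Pfunctional alpha tau p phi < +oo)%E.
  have [h _] := phiE phi f phiH1 fphi.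
  by apply/andP; split; [exact: Pfunctional_ge0|rewrite -(abs_pairing_self _ _ _ p1)].
have [w0 uw0] := H1_sqrtK u0H1.
have Lu0 : L2 (lebesgue_tuple n) u0 by case: uw0 => /in_Lp2P.
have [M M0 uM] := kinetic_bound p0 (fun t => Pfunctional_ge0 alpha tau p (u t)) Pphi
  (energy_lty alpha tau p0 uw0) ener Psup.
pose b := (32%:E * (sqint (lebesgue_tuple n) u0 + 4%:E * (M ^+ 2)%:E))%E.
have b0 : (0 <= b)%E.
  by rewrite mule_ge0// adde_ge0 ?sqint_ge0// mule_ge0// lee_fin sqr_ge0.
have bfin : b \is a fin_num by rewrite fin_numM// fin_numD fin_sqint// -EFinM.
apply: (@le_lt_trans _ _ (sqrte b)); last first.
  by rewrite -ge0_fin_numE ?sqrte_ge0// sqrte_fin_num.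
apply: ge_ereal_sup => _ [t tT <-].
(* The strict bound on the infimum [sqrtK_norm] yields a vector [w] = sqrt K u(t) of norm below [M],
   with [M] independent of t. *)
have [_ [w uw <-] wM] := ereal_inf_lt (uM t tT).
(* The regularity class is stated on compact intervals [0, T]; T = t gives u(t) in H^1. *)
have tt : t \in `[0, t] by rewrite in_itv/= lexx andbT; case: tT.
have [utH1 _] := (uCH1 t tT).1 t tt.
apply: le_trans (H1_norm_le utH1 uw) _.
(* Mass conservation replaces ||u(t)|| by ||u0||, which makes the bound uniform in time. *)
rewrite lee_sqrt// -sqr_Lp2 mass// sqr_Lp2; apply: lee_wpmul2l => //.
apply: leeD => //; apply: lee_wpmul2l => //.
by rewrite -sqr_Lp2 EFin_expe lee_sqr ?Lnorm_ge0 ?lee_fin// ltW.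
Qed.
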